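(* There is a universal constant $K>0$ such that the following holds. Let $G=(V_G,E_G)$ and $H=(V_H,E_H)$ be finite, simple, connected, unweighted, undirected graphs, each with at least two vertices, and let $F=(V_F,E_F)=G\Box H$ be their Cartesian product. Then $$\mathbf{COV}[F]\ \ge\ \max\left\{\left(1+\frac{\delta_G}{\Delta_H}\right)\mathbf{COV}[H],\ \left(1+\frac{\delta_H}{\Delta_G}\right)\mathbf{COV}[G]\right\}.$$ Suppose further that $n_H\ge D_G+1$. Then $$\mathbf{COV}[F]\ \le\ K\left(\left(1+\frac{\Delta_G}{\delta_H}\right)\mathbf{BCOV}[H]+\frac{M\,m_G\,m_H\,n_H\,\ell^2}{\mathbf{COV}[H]\,D_G}\right),$$ where $M=|E_F|=n_Gm_H+n_Hm_G$ and $\ell=\log(D_G+1)\,\log(n_GD_G)$.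
   Context: For a graph $\Gamma$: $n_\Gamma$ is the number of vertices, $m_\Gamma$ the number of edges, $\delta_\Gamma$ and $\Delta_\Gamma$ the minimum and maximum degree, and $D_\Gamma$ the diameter. Logarithms are natural. The Cartesian product $F=G\Box H$ has vertex set $V_G\times V_H$, and $((a,x),(b,y))$ is an edge if and only if either $(a,b)\in E_G$ and $x=y$, or $a=b$ and $(x,y)\in E_H$. A simple random walk on a graph moves at each discrete time step along an edge chosen uniformly at random from those incident with the current vertex. $\mathbf{COV}_u[\Gamma]$ is the expected number of steps for a simple random walk started at $u$ to visit every vertex of $\Gamma$, and the cover time is $\mathbf{COV}[\Gamma]=\max_u\mathbf{COV}_u[\Gamma]$. Blanket-cover time: let $\pi_v=\deg(v)/(2m_\Gamma)$ be the stationary probability of $v$, and let $N_v(t)$ be the number of visits to $v$ by time $t$ of a simple random walk on $\Gamma$ started at $u$. Put $\beta_u[\Gamma]=\min\{t:\ N_v(t)\ge \pi_v\,\mathbf{COV}[\Gamma]\ \text{for all } v\in V(\Gamma)\}$ and $\mathbf{BCOV}[\Gamma]=\max_u \mathbf{E}[\beta_u[\Gamma]]$. *)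

(* Defs.v *)
From mathcomp Require Import all_boot all_order all_algebra.
From mathcomp Require Import all_classical all_reals all_analysis.
From mathcomp Require Import measurable_realfun.

Set Implicit Arguments.
Unset Strict Implicit.
Unset Printing Implicit Defensive.
Import Order.TTheory GRing.Theory Num.Theory.

Local Open Scope ring_scope.

Record sgraph := SGraph {
  vertex :> finType;
  adj : rel vertex;
  adj_sym : symmetric adj;
  adj_irr : irreflexive adj }.
Arguments adj {s}.

Section Graph.
Variable G : sgraph.

Definition connected_graph := forall u v : G, connect adj u v.

Definition edges : {set {set G}} :=
  [set [set e.1; e.2] | e in [set e : G * G | adj e.1 e.2]].

Definition nvert : nat := #|{: G}|.
Definition nedge : nat := #|edges|.

Definition deg (u : G) : nat := #|[set v | adj u v]|.

(* Every degree is below #|G|, so the default value of the minimum is harmless. *)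
Definition mindeg : nat := \big[minn/nvert]_(u : G) deg u.
Definition maxdeg : nat := \max_(u : G) deg u.

(* A shortest walk has fewer than #|G| steps; the default value #|G| is taken
   exactly when there is no walk from u to v. *)
Definition dist (u v : G) : nat :=
  \big[minn/nvert]_(k < nvert |
      [exists p : k.-tuple G, path adj u p && (last u p == v)]) k.

Definition diam : nat := \max_(u : G) \max_(v : G) dist u v.

End Graph.

Section CartesianProduct.
Variables G H : sgraph.

Definition box_adj (u v : G * H) : bool :=
  adj u.1 v.1 && (u.2 == v.2) || (u.1 == v.1) && adj u.2 v.2.

Lemma box_adj_sym : symmetric box_adj.
Proof.
move=> u v; rewrite /box_adj [adj u.1 _]adj_sym [adj u.2 _]adj_sym.
by rewrite [u.1 == _]eq_sym [u.2 == _]eq_sym.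
Qed.

Lemma box_adj_irr : irreflexive box_adj.
Proof. by move=> u; rewrite /box_adj !adj_irr andbF. Qed.

Definition box : sgraph := SGraph box_adj_sym box_adj_irr.

End CartesianProduct.

Lemma handshake (G : sgraph) : (\sum_(u : G) deg u = 2 * nedge G)%N.
Proof.
pose A := [set e : G * G | adj e.1 e.2].
have -> : (\sum_(u : G) deg u = #|A|)%N.
  rewrite (eq_bigr (fun u => \sum_(v | adj u v) 1)%N); last first.
    by move=> u _; rewrite sum1_card /deg cardsE.
  by rewrite pair_big_dep /= sum1dep_card.
rewrite -sum1_card (partition_big (fun e : G * G => [set e.1; e.2])
  (mem (edges G))) /=; last by move=> e eA; apply/imsetP; exists e.
rewrite mulnC -sum_nat_const; apply: eq_bigr => B /imsetP[[u v]].
rewrite inE /= => uv ->; rewrite sum1dep_card.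
have uNv : u != v by apply/eqP => e; rewrite e adj_irr in uv.
have -> : [set e : G * G | (e \in A) && ([set e.1; e.2] == [set u; v])]
    = [set (u, v); (v, u)].
  apply/setP => -[a b]; rewrite !inE /= !xpair_eqE; apply/idP/idP.
    case/andP => ab /eqP E.
    have aNb : a != b by apply/eqP => e; rewrite e adj_irr in ab.
    have := set21 a b; have := set22 a b; rewrite E !inE.
    by case/pred2P=> eb /pred2P[] ea; move: aNb; rewrite ea eb !eqxx ?orbT.
  case/orP => /andP[/eqP-> /eqP->]; first by rewrite uv eqxx.
  by rewrite adj_sym uv finset.setUC eqxx.
by rewrite cards2 xpair_eqE (negbTE uNv).
Qed.

Lemma deg_box (G H : sgraph) (u : box G H) : (deg u = deg u.1 + deg u.2)%N.
Proof.
case: u => x y; rewrite /deg /=.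
have i1 : injective (fun a : G => (a, y)) by move=> a b [].
have i2 : injective (fun b : H => (x, b)) by move=> a b [].
rewrite -(card_imset _ i1) -[X in (_ + X)%N](card_imset _ i2).
rewrite -cardsUI -[LHS]addn0; congr addn; last first.
  apply/esym/eqP; rewrite cards_eq0; apply/eqP/setP => z; rewrite !inE.
  apply/negP => /andP[/imsetP[a + ->] /imsetP[b _ [E _]]].
  by rewrite inE E adj_irr.
congr #|pred_of_set _|; apply/setP => -[a b]; rewrite !inE /box_adj /=.
congr (_ || _); apply/idP/imsetP.
- by case/andP=> xa /eqP->; exists a; rewrite ?inE.
- by case=> c; rewrite inE => xc [-> ->]; rewrite xc eqxx.
- by case/andP=> /eqP-> yb; exists b; rewrite ?inE.
- by case=> c; rewrite inE => yc [-> ->]; rewrite yc eqxx.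
Qed.

Lemma nedge_box (G H : sgraph) :
  (nedge (box G H) = nvert G * nedge H + nvert H * nedge G)%N.
Proof.
apply/eqP; rewrite -(eqn_pmul2l (isT : 0 < 2)%N) -handshake; apply/eqP.
rewrite (eq_bigr _ (fun u _ => deg_box u)) big_split /=.
rewrite -(pair_big xpredT xpredT (fun (x : G) (_ : H) => deg x)) /=.
rewrite -(pair_big xpredT xpredT (fun (_ : G) (y : H) => deg y)) /=.
rewrite exchange_big /= !sum_nat_const !handshake.
by rewrite mulnDr !(mulnCA 2) addnC.
Qed.

Section RandomWalk.
Variables (R : realType) (G : sgraph).

Definition step (u v : G) : R := if adj u v then (deg u)%:R^-1 else 0.

(* Probability that the first size p steps of the walk started at u lead
   successively to the vertices listed in p. *)
Fixpoint walk_prob (u : G) (p : seq G) : R :=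
  if p is v :: p' then step u v * walk_prob v p' else 1.

(* A stopping rule A is a predicate on histories: the walk X is stopped at the
   time min {t | A [:: X_0; ...; X_t]}. The predicate below says that this time
   is size p when the walk starts at u and makes its first steps along p. *)
Definition stops_at (A : pred (seq G)) (u : G) (p : seq G) : bool :=
  A (u :: p) && [forall k : 'I_(size p), ~~ A (u :: take k p)].

Definition stop_prob (A : pred (seq G)) (u : G) (t : nat) : R :=
  \sum_(p : t.-tuple G | stops_at A u p) walk_prob u p.

(* Expectation of the stopping time for the walk started at u. The time takes
   the value +oo with the remaining probability; since +oo * 0 = 0, the second
   term vanishes for an almost surely finite time. *)
Definition expected_stop (A : pred (seq G)) (u : G) : \bar R :=
  (\sum_(0 <= t <oo) t%:R%:E * (stop_prob A u t)%:E
   + +oo * (1 - \sum_(0 <= t <oo) (stop_prob A u t)%:E))%E.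

Definition covers (s : seq G) : bool := [forall v, v \in s].

Definition COV_from (u : G) : \bar R := expected_stop covers u.

Definition COV : \bar R := \big[maxe/0%E]_(u : G) COV_from u.

Definition stationary (v : G) : R := (deg v)%:R / (2 * nedge G)%:R.

(* count_mem v [:: X_0; ...; X_t] is the number of visits to v by time t, the
   starting position counting as a visit. *)
Definition blankets (s : seq G) : bool :=
  [forall v, ((stationary v)%:E * COV <= (count_mem v s)%:R%:E)%E].

Definition BCOV : \bar R :=
  \big[maxe/0%E]_(u : G) expected_stop blankets u.

End RandomWalk.

Section Process.
Local Open Scope classical_set_scope.
Local Open Scope ereal_scope.
Context (d : measure_display) (T : measurableType d) (R : realType)
  (P : probability T R) (G : sgraph).

(* X is a simple random walk started at u: the law of its first steps is the
   product of the transition probabilities. *)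
Definition is_srw (u : G) (X : nat -> T -> G) : Prop :=
  (forall t v, measurable (X t @^-1` [set v])) /\
  (forall t (p : t.-tuple G),
      P [set w | mkseq (X^~ w) t.+1 = u :: p] = (walk_prob R u p)%:E).

Definition stop_time (A : pred (seq G)) (x : nat -> G) : \bar R :=
  ereal_inf [set t%:R%:E | t in [set t | A (mkseq x t.+1)]].

Variables (u : G) (X : nat -> T -> G) (A : pred (seq G)).
Hypothesis srwX : is_srw u X.

Let stops s := if s is v :: p then stops_at A v p else false.
Let F t := [set w | stops (mkseq (X^~ w) t.+1)].

Let stopsP (x : nat -> G) t : stops (mkseq x t.+1) <->
  A (mkseq x t.+1) /\ forall k, (k < t)%N -> ~~ A (mkseq x k.+1).
Proof.
have E n : mkseq x n.+1 = x 0%N :: mkseq (x \o S) n.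
  by rewrite /mkseq /= (iotaDl 1 0) -map_comp.
have K k : (k < t)%N ->
    A (x 0%N :: take k (mkseq (x \o S) t)) = A (mkseq x k.+1).
  move=> kt; rewrite E /mkseq -map_take take_iota.
  by rewrite (minn_idPl (ltnW kt)).
rewrite {1}E /stops /stops_at -E size_mkseq; split.
  case/andP=> At /forallP nA; split=> // k kt.
  by rewrite -K//; exact: (nA (Ordinal kt)).
move=> [-> nA]; apply/forallP => -[k kt] /=; rewrite K//; exact: nA.
Qed.

Let stop_time_first w t : F t w -> stop_time A (X^~ w) = t%:R%:E.
Proof.
move=> /stopsP[At nA]; apply/eqP; rewrite eq_le; apply/andP; split.
  by apply: ereal_inf_lbound; exists t.
apply: le_ereal_inf_tmp => _ [s /= As <-]; rewrite lee_fin ler_nat leqNgt.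
by apply/negP => /nA; rewrite As.
Qed.

Let stop_time_never w : (~` \bigcup_t F t) w -> stop_time A (X^~ w) = +oo.
Proof.
move=> nF; rewrite /stop_time (_ : [set _ | _ in _] = set0) ?ereal_inf0//.
apply/seteqP; split=> // _ [t /= At _]; apply: nF.
have exA : exists t, A (mkseq (X^~ w) t.+1) by exists t.
have [m Am mP] := ex_minnP exA; exists m => //; apply/stopsP; split=> // k km.
by apply/negP => /mP; rewrite leqNgt km.
Qed.

Let m_hist (Q : pred (seq G)) t : measurable [set w | Q (mkseq (X^~ w) t)].
Proof.
have mX := srwX.1; elim: t Q => [|t IH] Q.
  by rewrite /mkseq /=; case: (Q [::]); rewrite ?set_true ?set_false.
rewrite (_ : [set _ | _] = \bigcup_(v in [set: G])
  (X t @^-1` [set v] `&` [set w | Q (rcons (mkseq (X^~ w) t) v)])).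
  apply: fin_bigcup_measurable => [|v _]; first exact: finite_finset.
  by apply: measurableI => //; exact: (IH (fun s => Q (rcons s v))).
apply/seteqP; split=> w /=; rewrite mkseqS.
  by exists (X t w).
by case=> v _ /= [->].
Qed.

Let mF t : measurable (F t).
Proof. exact: m_hist. Qed.

Let trivF : trivIset setT F.
Proof.
apply/trivIsetP => i j _ _ ij; apply/seteqP; split=> // w [].
move=> /stop_time_first + /stop_time_first => -> [] /eqP.
by rewrite eqr_nat (negbTE ij).
Qed.

Let PF t : P (F t) = (stop_prob R A u t)%:E.
Proof.
have [_ wX] := srwX.
pose C (p : t.-tuple G) := [set w | mkseq (X^~ w) t.+1 = u :: p].
have mC p : measurable (C p).
  rewrite /C (_ : [set _ | _] = [set w | mkseq (X^~ w) t.+1 == u :: p]).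
    exact: (m_hist (fun s => s == u :: p) t.+1).
  by apply/seteqP; split=> w /= /eqP.
have trivC (D : set (t.-tuple G)) : trivIset D C.
  apply/trivIsetP => p q _ _ pq; apply/seteqP; split=> // w [].
  by rewrite /C /= => -> [] /val_inj/eqP; rewrite (negbTE pq).
pose r := [seq p : t.-tuple G <- index_enum _ | stops_at A u p].
have -> : (stop_prob R A u t)%:E = P (\bigcup_(p in [set` r]) C p).
  rewrite measure_fin_bigcup// -fsbig_seq ?filter_uniq ?index_enum_uniq//.
  rewrite big_filter /stop_prob -sumEFin; apply: eq_bigr => p _.
  by rewrite -wX.
have mB : measurable (\bigcup_(p in [set` r]) C p).
  by apply: fin_bigcup_measurable.
have Bw w : X 0%N w = u -> F t w -> (\bigcup_(p in [set` r]) C p) w.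
  move=> Xu Fw; have hw : mkseq (X^~ w) t.+1 = u :: mkseq (fun i => X i.+1 w) t.
    by rewrite /mkseq /= (iotaDl 1 0) -map_comp Xu.
  have sz : size (mkseq (fun i => X i.+1 w) t) == t by rewrite size_mkseq.
  exists (Tuple sz) => //=.
  have : stops (mkseq (X^~ w) t.+1) := Fw.
  by rewrite hw mem_filter mem_index_enum andbT.
have BF : \bigcup_(p in [set` r]) C p `<=` F t.
  move=> w [p /=]; rewrite mem_filter => /andP[Ap _] Cp.
  by have : stops (mkseq (X^~ w) t.+1) by rewrite Cp.
have P0 : P [set w | X 0%N w != u] = 0.
  have := wX 0%N [tuple]; rewrite /= => wX0.
  have <- : ~` [set w | mkseq (X^~ w) 1 = u :: [tuple]] = [set w | X 0%N w != u].
    apply/seteqP; split=> w /=; rewrite /mkseq /=.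
      by move=> h; apply/eqP => e; apply: h; rewrite e.
    by move=> /eqP h [].
  rewrite probability_setC ?wX0 ?subee//.
  have := srwX.1 0%N u; congr measurable; apply/seteqP; split=> w /=.
    by move=> <-.
  by case.
rewrite -(setDKU BF) measureU//; last 2 first.
- exact: measurableD.
- by rewrite setDKI.
rewrite [X in X + _](_ : _ = 0) ?add0e//.
have mX0 : measurable [set w | X 0%N w != u].
  rewrite (_ : [set _ | _] = ~` (X 0%N @^-1` [set u])).
    by apply: measurableC; exact: srwX.1.
  by apply/seteqP; split=> w /= /eqP.
apply: (subset_measure0 _ _ _ P0) => //; first exact: measurableD.
move=> w [Fw nB] /=; apply/eqP => Xu; apply: nB; exact: Bw.
Qed.

(* On every probability space that carries the walk, expected_stop is the
   expectation of the stopping time. *)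
Lemma expected_stop_srw :
  \int[P]_w stop_time A (X^~ w) = expected_stop R A u.
Proof.
have mU : measurable (\bigcup_t F t) by apply: bigcup_measurable => t _; exact: mF.
pose f w : \bar R := stop_time A (X^~ w).
have mfU : measurable_fun (\bigcup_t F t) f.
  apply/measurable_fun_bigcup => // t.
  apply: (eq_measurable_fun (cst t%:R%:E)) => [w|]; last exact: measurable_cst.
  by rewrite inE /f => /stop_time_first ->.
have mfN : measurable_fun (~` \bigcup_t F t) f.
  apply: (eq_measurable_fun (cst +oo)) => [w|]; last exact: measurable_cst.
  by rewrite inE /f => /stop_time_never ->.
have ge0 w : 0 <= stop_time A (X^~ w).
  by apply: le_ereal_inf_tmp => _ [t _ <-]; rewrite lee_fin.
rewrite -[X in integral _ X _](setUv (\bigcup_t F t)).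
rewrite ge0_integral_setU//; last 3 first.
- exact: measurableC.
- by apply/measurable_funU => //; exact: measurableC.
- by apply/disj_set2P; exact: setICr.
congr (_ + _).
  rewrite ge0_integral_bigcup//; apply: eq_eseriesr => t _.
  rewrite -PF -integral_cst//; apply: eq_integral => w.
  by rewrite inE /f => /stop_time_first ->.
rewrite (eq_integral (cst +oo)); last by move=> w; rewrite inE => /stop_time_never ->.
rewrite integral_cst; last exact: measurableC.
congr (_ * _); transitivity (P (~` \bigcup_t F t)) => //.
rewrite probability_setC// measure_bigcup//; congr (_ - _).
rewrite (@eq_eseriesl _ _ xpredT) => [|t]; last by rewrite in_setT.
by apply: eq_eseriesr => t _; exact: PF.
Qed.
End Process.

(* Main.v *)
Require Import Defs.
From mathcomp Require Import all_boot all_order all_algebra.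
From mathcomp Require Import all_classical all_reals all_analysis.
From mathcomp Require Import ring lra zify.

(** Every estimate is a comparison, through a minimum principle, of an expected
    stopping time with an explicit superharmonic function of the state of the
    walk (current vertex, visited set, or whole history).

    The projection of the walk on G x H to H is a walk on H slowed down by a
    factor between 1 + delta_G / Delta_H and 1 + Delta_G / delta_H, which gives
    the lower bound.

    For the upper bound, cut H into O(n_H / D_G) pieces B with at most D_G + 1
    vertices and diameter at most 2 D_G. First let the projected walk blanket H;
    then let it cover H once more and, at the first entrance into an unvisited
    G x B, make a detour that covers G x B and returns to the entrance. Two
    vertices of G x B are at effective resistance O(log D_G), so Matthews'
    argument bounds the time spent in G x B before covering it by
    O(vol(G x B) log D_G log(n_G D_G)), and a detour by O(M log D_G log(n_G D_G)).
    By Markov's inequality G x B is unvisited at the blanket time with probability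
    O(m_G m_H log D_G log(n_G D_G) / COV[H]); summing the expected costs of the
    detours gives the second term.

    The resistance bound is proved on functions: the averages of phi over
    {p_i} x B_i, where p is a geodesic of G and B_i consists of i + 1 vertices
    of H near x, move by O(sqrt(E_i / i)) when i increases, with disjoint local
    energies E_i, whence the factor sum 1 / i. *)

Set Implicit Arguments.
Unset Strict Implicit.
Unset Printing Implicit Defensive.
Import Order.TTheory GRing.Theory Num.Theory numFieldNormedType.Exports.
Local Open Scope ring_scope.

(** * Superharmonic functions and expected stopping times *)

Section MarkovOperator.
Variables (R : realType) (G : sgraph).
Hypothesis deg_gt0 : forall u : G, (0 < deg u)%N.
Local Notation step := (step R).

Lemma step_ge0 (u v : G) : 0 <= step u v.
Proof. by rewrite /Defs.step; case: ifP => // _; rewrite invr_ge0. Qed.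

Lemma sum_step (u : G) (f : G -> R) :
  \sum_v step u v * f v = (deg u)%:R^-1 * \sum_(v | adj u v) f v.
Proof.
rewrite mulr_sumr [RHS]big_mkcond; apply: eq_bigr => v _.
by rewrite /Defs.step; case: ifP => // _; rewrite mul0r.
Qed.

Lemma step_sum1 (u : G) : \sum_v step u v = 1.
Proof.
rewrite -(eq_bigr _ (fun v _ => mulr1 (step u v))) sum_step sumr_const /deg cardsE.
rewrite mulVf// pnatr_eq0 -lt0n.
by have := deg_gt0 u; rewrite /deg cardsE.
Qed.

(* The walk drives a state, updated by upd at every move, from which cur reads
   the current vertex; the state may record the visited set or the whole history. *)
Variables (T : Type) (cur : T -> G) (upd : T -> G -> T).

Definition mean (f : T -> R) (s : T) : R := \sum_v step (cur s) v * f (upd s v).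

Lemma mean_le (f g : T -> R) (s : T) :
  (forall v, adj (cur s) v -> f (upd s v) <= g (upd s v)) ->
  mean f s <= mean g s.
Proof.
move=> fg; apply: ler_sum => v _; rewrite /Defs.step; case: ifP => [uv|_].
  by rewrite ler_wpM2l ?invr_ge0// fg.
by rewrite !mul0r.
Qed.

Lemma eq_mean (f g : T -> R) (s : T) :
  (forall v, adj (cur s) v -> f (upd s v) = g (upd s v)) ->
  mean f s = mean g s.
Proof.
by move=> fg; apply/eqP; rewrite eq_le !mean_le// => v uv; rewrite fg.
Qed.

Lemma mean_cst (c : R) s : mean (fun=> c) s = c.
Proof. by rewrite /mean -mulr_suml step_sum1 mul1r. Qed.

Lemma meanD (f g : T -> R) s : mean (fun s => f s + g s) s = mean f s + mean g s.
Proof.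
by rewrite /mean -big_split; apply: eq_bigr => v _; rewrite mulrDr.
Qed.

Lemma meanZ (c : R) (f : T -> R) s : mean (fun s => c * f s) s = c * mean f s.
Proof. by rewrite /mean mulr_sumr; apply: eq_bigr => v _; rewrite mulrCA. Qed.

Lemma meanB (f g : T -> R) s : mean (fun s => f s - g s) s = mean f s - mean g s.
Proof.
by rewrite /mean -sumrB; apply: eq_bigr => v _; rewrite mulrBr.
Qed.

Lemma mean_sum (I : finType) (P : pred I) (f : I -> T -> R) s :
  mean (fun s => \sum_(i | P i) f i s) s = \sum_(i | P i) mean (f i) s.
Proof.
rewrite /mean exchange_big /=; apply: eq_bigr => v _; by rewrite mulr_sumr.
Qed.

Lemma mean_ge0 (f : T -> R) s :
  (forall v, adj (cur s) v -> 0 <= f (upd s v)) -> 0 <= mean f s.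
Proof. by move=> f0; rewrite -(mean_cst 0 s); exact: mean_le. Qed.

(* Adding a small multiple of L makes f strictly superharmonic, so its lower
   bound improves by a fixed amount at each step. *)
Lemma min_principle (Inv : T -> Prop) (A : pred T) (f L : T -> R) (C : R) :
  (forall s v, Inv s -> ~~ A s -> adj (cur s) v -> Inv (upd s v)) ->
  (forall s, Inv s -> 0 <= L s) ->
  (forall s, Inv s -> ~~ A s -> 1 + mean L s <= L s) ->
  (forall s, Inv s -> - C <= f s) ->
  (forall s, Inv s -> A s -> 0 <= f s) ->
  (forall s, Inv s -> ~~ A s -> mean f s <= f s) ->
  forall s, Inv s -> 0 <= f s.
Proof.
move=> InvS L0 LS fC fA fS.
have H (e : R) : 0 < e -> forall k s, Inv s ->
    Num.min 0 (- C + k%:R * e) <= f s + e * L s.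
  move=> e0; elim=> [|k IH] s Is.
    rewrite mul0r addr0 ge_min; apply/orP; right.
    by rewrite -[leLHS]addr0 lerD ?fC// mulr_ge0 ?L0// ltW.
  have [As|nAs] := boolP (A s).
    by rewrite ge_min addr_ge0// ?fA// mulr_ge0 ?L0// ltW.
  have := fS _ Is nAs; have := LS _ Is nAs => Ls fs.
  have : Num.min 0 (- C + k%:R * e) <= mean f s + e * mean L s.
    rewrite -meanZ -meanD -[leLHS](mean_cst _ s); apply: mean_le => v uv.
    exact/IH/InvS.
  have /(ler_wpM2l (ltW e0)) : mean L s <= L s - 1 by rewrite lerBrDl.
  rewrite mulrBr mulr1 => Ls' m.
  rewrite -natr1 mulrDl mul1r addrA.
  have : Num.min 0 (- C + k%:R * e) + e <= f s + e * L s.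
    by rewrite -lerBrDr; apply: (le_trans m); rewrite -addrA lerD.
  apply: le_trans; rewrite addr_minl add0r le_min ge_min ltW//=.
  by rewrite ge_min lexx orbT.
move=> s Is; apply/ler_addgt0Pr => e e0.
(* [d] keeps [d * L s] below [e], and after [k] steps the gain [k * d] has made up for [C]. *)
pose d := e / (L s + 1); set k := Num.bound (`|C| / d).
have L1 : 0 < L s + 1 by rewrite ltr_wpDl ?L0.
have d0 : 0 < d by rewrite divr_gt0.
have := H d d0 k s Is.
have : 0 <= - C + k%:R * d.
  rewrite addrC subr_ge0 (le_trans (ler_norm _))// -ler_pdivrMr//.
  by rewrite ltW// archi_boundP// divr_ge0// ltW.
move=> /min_idPl ->; move=> /le_trans; apply; rewrite lerD2l.
rewrite /d mulrAC ler_pdivrMr// ler_wpM2l ?lerDl//; exact: ltW.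
Qed.

(** [V] is the limit of the expected costs [W n] collected during the first n steps before stopping.
    They increase with n and stay below the supersolution [L]. *)
Lemma value_exists (A : pred T) (b L : T -> R) :
  (forall s, 0 <= b s) -> (forall s, 0 <= L s) ->
  (forall s, ~~ A s -> b s + mean L s <= L s) ->
  exists V : T -> R, [/\ forall s, 0 <= V s <= L s,
    forall s, A s -> V s = 0 & forall s, ~~ A s -> V s = b s + mean V s].
Proof.
move=> b0 L0 LS.
pose W := fix W n s := if n is n'.+1 then
  (if A s then 0 else b s + mean (W n') s) else 0.
have WS n s : W n.+1 s = if A s then 0 else b s + mean (W n) s by [].
have W0 n s : 0 <= W n s.
  elim: n s => [//|n IH] s; rewrite WS; case: ifP => // _.
  by rewrite addr_ge0// mean_ge0.
have Wnd s : nondecreasing_seq (W^~ s).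
  apply/nondecreasing_seqP => n; elim: n s => [|n IH] s; first exact: (W0 1).
  rewrite !WS; case: ifP => // _; rewrite lerD2l; apply: mean_le => v _; exact: IH.
have WL n s : W n s <= L s.
  elim: n s => [|n IH] s; first exact: L0.
  rewrite WS; case: ifPn => // nA; apply: le_trans (LS _ nA); rewrite lerD2l.
  by apply: mean_le => v _; exact: IH.
have Wcvg s : cvgn (W^~ s).
  apply: nondecreasing_is_cvgn => //; exists (L s) => _ [n _ <-]; exact: WL.
exists (fun s => limn (W^~ s)); split=> s.
- rewrite limr_ge//=; last exact: nearW.
  by apply: limr_le => //; exact: nearW.
- move=> As; apply: lim_near_cst; first exact: norm_hausdorff.
  by apply: nearW => -[//|n]; rewrite WS As.
- move=> nA; apply: cvg_lim; first exact: norm_hausdorff.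
  rewrite -(cvg_shiftS (W^~ s)) /=.
  rewrite (_ : (fun n => _) = (fun n => b s + mean (W n) s)); last first.
    by apply/funext => n; rewrite (negbTE nA).
  apply: cvgD; first exact: cvg_cst.
  apply: cvg_big => [|v _]; first exact: add_continuous.
  by apply: cvgM; [exact: cvg_cst | exact: Wcvg].
Qed.

End MarkovOperator.

(** * Expected stopping times from first-step equations *)

Section ExpectedStop.
Variables (R : realType) (G : sgraph).
Hypothesis deg_gt0 : forall u : G, (0 < deg u)%N.
Variables (A : pred (seq G)) (u : G).
Local Notation step := (step R).
Local Notation smean := (mean (last u) (@rcons G)).

(* Expectation of f at time n on the event that the walk, continued from the
   history q, has not been stopped before time n. *)
Fixpoint alive (f : seq G -> R) (n : nat) (q : seq G) : R :=
  if n is n'.+1 then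
    (if A (u :: q) then 0 else smean (alive f n') q)
  else f q.

(** The history q is kept apart from its extension p so that [stop_prob_alive] can be proved by
    induction for all histories at once. *)
Let stops q p := A (u :: q ++ p) &&
  all (fun k => ~~ A (u :: q ++ take k p)) (iota 0 (size p)).

Let stops_atE p : stops_at A u p = stops [::] p.
Proof.
rewrite /stops_at /stops; congr andb; apply/forallP/allP => /= h k.
  by rewrite mem_iota add0n => kp; exact: (h (Ordinal kp)).
by apply: h; rewrite mem_iota add0n ltn_ord.
Qed.

Lemma stop_prob_alive n :
  stop_prob R A u n = alive (fun p => (A (u :: p))%:R) n [::].
Proof.
rewrite /stop_prob; under eq_bigl do rewrite stops_atE.
rewrite -[u in walk_prob R u]/(last u [::]).
elim: n [::] => [|n IH] q.
  rewrite big_mkcond (bigD1 [tuple]) //=.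
  rewrite big1 => [|i]; last by rewrite tuple0.
  by rewrite addr0 /stops cats0 andbT; case: ifP.
pose h (z : G * n.-tuple G) := cons_tuple z.1 z.2.
have hbij : bijective h.
  exists (fun t => (thead t, behead_tuple t)) => [[v p]|t].
    by rewrite theadE; congr pair; exact/val_inj.
  by rewrite /h /= [RHS]tuple_eta; exact/val_inj.
rewrite (reindex h) /=; last exact: onW_bij.
have E v p : stops q (v :: p) = ~~ A (u :: q) && stops (rcons q v) p.
  rewrite /stops /= cats0 (iotaDl 1 0) all_map cat_rcons andbCA; congr (_ && (_ && _)).
  by apply: eq_all => k /=; rewrite cat_rcons.
under eq_bigl do rewrite E.
case: ifP => [Aq|nA]; first by rewrite big_pred0_eq.
rewrite -(pair_big_dep xpredT (fun v (p : n.-tuple G) => stops (rcons q v) p)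
  (fun v p => step (last u q) v * walk_prob R v p)) /=.
apply: eq_bigr => v _; rewrite -mulr_sumr -IH last_rcons.
by congr (_ * _); apply: eq_bigl => p; rewrite /stops.
Qed.

(** [alive] unfolds at the first step; peeling off the last step instead allows times n and n + 1 to
    be compared. *)
Lemma alive_last f n q :
  alive f n.+1 q =
  alive (fun q => if A (u :: q) then 0 else smean f q) n q.
Proof.
elim: n q => [//|n IH] q.
transitivity (if A (u :: q) then 0 else smean (alive f n.+1) q) => //.
rewrite [RHS]/=; case: ifP => // _; apply: eq_mean => v _; exact: IH.
Qed.

Lemma aliveD f g n q :
  alive (fun q => f q + g q) n q = alive f n q + alive g n q.
Proof.
elim: n q => [//|n IH] q /=; case: ifP => _; first by rewrite addr0.
by rewrite -meanD; apply: eq_mean => v _; exact: IH.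
Qed.

Lemma aliveZ c f n q : alive (fun q => c * f q) n q = c * alive f n q.
Proof.
elim: n q => [//|n IH] q /=; case: ifP => _; first by rewrite mulr0.
by rewrite -meanZ; apply: eq_mean => v _; exact: IH.
Qed.

Lemma alive_le f g n q : (forall q, f q <= g q) -> alive f n q <= alive g n q.
Proof.
move=> fg; elim: n q => [//|n IH] q /=; case: ifP => // _.
by apply: mean_le => v _; exact: IH.
Qed.

Lemma alive_ge0 f n q : (forall q, 0 <= f q) -> 0 <= alive f n q.
Proof.
move=> f0; elim: n q => [//|n IH] q /=; case: ifP => // _.
by apply: mean_ge0 => // v _; exact: IH.
Qed.

Let stop n := alive (fun p => (A (u :: p))%:R) n [::].
Let surv n := alive (fun=> 1) n [::].

Let survS n : surv n = stop n + surv n.+1.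
Proof.
rewrite /surv alive_last -aliveD; congr alive; apply/funext => q.
by rewrite mean_cst//; case: ifP => _; rewrite ?addr0 ?add0r.
Qed.

Let stop0 n : 0 <= stop n.
Proof. by apply: alive_ge0 => q; rewrite ler0n. Qed.

Let surv0 n : 0 <= surv n.
Proof. by apply: alive_ge0 => q; rewrite ler01. Qed.

Let sum_stop n : \sum_(0 <= t < n) stop t = 1 - surv n.
Proof.
elim: n => [|n IH]; first by rewrite big_geq// subrr.
by rewrite big_nat_recr//= IH (survS n); lra.
Qed.

(** Iterating the first-step equation gives [main]. Hence [surv n] is at most [V [::] / n], and
    boundedness of [V] makes the last term of [main] vanish; [tail] deals with [n * surv n]. In
    particular the walk stops almost surely, so the infinite part of [expected_stop] is 0. *)
Lemma expected_stopE (V : seq G -> R) (C : R) :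
  (forall p, 0 <= V p <= C) -> (forall p, A (u :: p) -> V p = 0) ->
  (forall p, ~~ A (u :: p) -> V p = 1 + smean V p) ->
  expected_stop R A u = (V [::])%:E.
Proof.
move=> VC VA VS.
have V0 p : 0 <= V p by case/andP: (VC p).
have V_le p : V p <= C by case/andP: (VC p).
have C0 : 0 <= C by apply: le_trans (V_le [::]).
pose S n := \sum_(0 <= t < n) t%:R * stop t.
have main n : V [::] = S n + n%:R * surv n + alive V n [::].
  elim: n => [|n IH]; first by rewrite /S big_geq// mul0r !add0r.
  rewrite {1}IH [S n.+1](_ : _ = S n + n%:R * stop n); last first.
    by rewrite /S big_nat_recr.
  have -> : alive V n [::] = surv n.+1 + alive V n.+1 [::].
    rewrite /surv !alive_last -aliveD; congr alive; apply/funext => q.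
    case: ifPn => [/VA ->|/VS ->]; first by rewrite addr0.
    by rewrite mean_cst.
  by rewrite (survS n) -[n.+1%:R]natr1; ring.
have aV0 n : 0 <= alive V n [::] by apply: alive_ge0.
have aVC n : alive V n [::] <= C * surv n.
  rewrite -aliveZ; apply: alive_le => q; by rewrite mulr1.
have S0 n : 0 <= S n by apply: sumr_ge0 => t _; rewrite mulr_ge0.
have S_le n : S n <= V [::].
  by rewrite (main n) -addrA lerDl addr_ge0// mulr_ge0.
have nsurv n : n%:R * surv n <= V [::].
  by rewrite (main n) addrAC lerDr addr_ge0.
(* A walk alive at time n and stopped before m contributes at least n to [S m - S n]. *)
have tail n m : (n <= m)%N -> n%:R * surv n <= S m - S n + n%:R * surv m.
  move=> nm; have := sum_stop m; have := sum_stop n.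
  rewrite /S !(big_cat_nat (leq0n n) nm) /= => -> e.
  rewrite [X in X - _]addrC addrK.
  have -> : surv n = \sum_(n <= t < m) stop t + surv m by lra.
  rewrite mulrDr lerD2r mulr_sumr; apply: ler_sum_nat => t /andP[nt _].
  by rewrite ler_wpM2r// ler_nat.
(* For m = (n + 1)^2 the leftover [n.+1 * surv m] of [tail] is at most [V [::] / n.+1]. *)
have lowb n : V [::] - (V [::] + C * V [::]) / n.+1%:R <= S (n.+1 * n.+1)%N.
  set m := (n.+1 * n.+1)%N.
  have n0 : (0 : R) < n.+1%:R by rewrite ltr0n.
  have nm : (n.+1 <= m)%N by rewrite leq_pmulr.
  have t1 := tail _ _ nm; have m1 := main n.+1; have a1 := aVC n.+1.
  have s1 : surv n.+1 <= V [::] / n.+1%:R.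
    by rewrite ler_pdivlMr// mulrC.
  have s2 : n.+1%:R * surv m <= V [::] / n.+1%:R.
    rewrite ler_pdivlMr// mulrAC -natrM -/m mulrC.
    by have := nsurv m; rewrite mulrC.
  have s3 := ler_wpM2l C0 s1.
  rewrite mulrDl -[C * V [::] / _]mulrA; move: m1 a1 t1 s2 s3; rewrite -/m.
  by move: (V [::] / _) (alive V _ _) (C * _) (C * _) (n.+1%:R * _) (n.+1%:R * _) => *; lra.
have survV n : surv n.+1 <= V [::] / n.+1%:R.
  by rewrite ler_pdivlMr ?ltr0n// mulrC.
have V00 := V0 [::].
have E1 : (\sum_(0 <= t <oo) (stop_prob R A u t)%:E = 1)%E.
  apply: cvg_lim => //.
  rewrite (_ : (fun n => _) = EFin \o (fun n => 1 - surv n)); last first.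
    apply/funext => n; rewrite /= -sum_stop -sumEFin.
    by apply: eq_bigr => t _; rewrite stop_prob_alive.
  apply: cvg_EFin; first by apply: nearW.
  suff surv_cvg : (surv n @[n --> \oo] --> 0)%classic.
    by rewrite -[in X in _ _ X](subr0 1); apply: cvgB => //; exact: cvg_cst.
  rewrite -(cvg_shiftS surv).
  apply: (@squeeze_cvgr _ _ _ _ (fun=> 0) (fun n => V [::] * n.+1%:R^-1)).
  - by apply: nearW => n; rewrite survV surv0.
  - exact: cvg_cst.
  - rewrite -(mulr0 (V [::])); apply: cvgM; first exact: cvg_cst.
    exact: cvg_harmonic.
have E2 : (\sum_(0 <= t <oo) t%:R%:E * (stop_prob R A u t)%:E = (V [::])%:E)%E.
  have SE n : (\sum_(0 <= t < n) t%:R%:E * (stop_prob R A u t)%:E = (S n)%:E)%E.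
    by rewrite -sumEFin; apply: eq_bigr => t _; rewrite stop_prob_alive.
  have ge0 t : (0 <= t%:R%:E * (stop_prob R A u t)%:E)%E.
    by rewrite stop_prob_alive -EFinM lee_fin mulr_ge0 ?ler0n//; exact: stop0.
  apply/eqP; rewrite eq_le; apply/andP; split.
    apply: lime_le; first exact: is_cvg_nneseries.
    by apply: nearW => n /=; rewrite SE lee_fin.
  apply/lee_addgt0Pr => e e0.
  have D0 : 0 <= V [::] + C * V [::] by rewrite addr_ge0// mulr_ge0.
  have := archi_boundP (divr_ge0 D0 (ltW e0)).
  set k := Num.bound _ => kb.
  have [n nk] : exists n, ((V [::] + C * V [::]) / e < n.+1%:R).
    by exists k; rewrite (lt_le_trans kb)// ler_nat.
  have Sn : V [::] <= S (n.+1 * n.+1)%N + e.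
    have := lowb n.
    have : (V [::] + C * V [::]) / n.+1%:R <= e.
      by rewrite ler_pdivrMr ?ltr0n// [e * _]mulrC -ler_pdivrMr// ltW.
    by move: (S _) (_ / _) => x y *; lra.
  apply: (@le_trans _ _ (S (n.+1 * n.+1)%N + e)%:E); first by rewrite lee_fin.
  rewrite EFinD leeD2r// -SE.
  exact: nneseries_lim_ge.
by rewrite /expected_stop E1 E2 subee// mule0 adde0.
Qed.

End ExpectedStop.

(** * Graph distance and hitting times *)

Lemma bigminn_leq (I : eqType) (s : seq I) (P : pred I) (F : I -> nat) x0 i :
  i \in s -> P i -> (\big[minn/x0]_(j <- s | P j) F j <= F i)%N.
Proof.
elim: s => // j s IH; rewrite inE big_cons => /predU1P[<- Pi|/IH H Pi].
  by rewrite Pi geq_minl.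
by case: ifP => _; [rewrite (leq_trans (geq_minr _ _)) ?H | exact: H].
Qed.

Section Distance.
Variable G : sgraph.
Hypothesis Gconn : connected_graph G.

Lemma dist_le (u v : G) (p : seq G) :
  path adj u p -> last u p = v -> (dist u v <= size p)%N.
Proof.
(* [dist] ranges only over lengths below [nvert], hence the shortening to a simple path. *)
move=> pp lp; have := lp; case/shortenP: (pp) => q qp uq sub lq.
have szqp := uniq_leq_size (proj2 (andP uq)) sub.
apply: leq_trans szqp.
have szq : (size q < nvert G)%N.
  by rewrite -[(_ < _)%N]/(size (u :: q) <= _)%N -(card_uniqP uq) max_card.
rewrite /dist -[X in (_ <= X)%N]/(val (Ordinal szq)).
apply: (@bigminn_leq _ _ _ (@nat_of_ord _)); first exact: mem_index_enum.
by apply/existsP; exists (in_tuple q); rewrite qp lq eqxx.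
Qed.

Lemma dist_path (u v : G) :
  exists p, [/\ path adj u p, last u p = v, uniq (u :: p) & size p = dist u v].
Proof.
have [q0 qp0 lq0] := connectP (Gconn u v).
(* The minimum is either the default value, which a simple path rules out, or attained. *)
have [E|[k Pk Ek]] : dist u v = nvert G \/
    exists2 k : 'I_(nvert G), [exists p : k.-tuple G,
       path adj u p && (last u p == v)] & dist u v = k.
- rewrite /dist; elim/big_rec: _ => [|k d Pk [->|[l Pl ->]]]; first by left.
    right; exists k; first exact: Pk.
    by apply/minn_idPl; exact: ltnW.
  by right; case: (leqP k l) => ?; [exists k | exists l].
- move: lq0; case/shortenP: qp0 => q qp uq _ lq.
  have := dist_le qp (esym lq); rewrite E => h.
  have : (size (u :: q) <= nvert G)%N by rewrite -(card_uniqP uq) max_card.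
  by rewrite /= ltnNge h.
have [p /andP[pp /eqP lp]] := existsP Pk.
move: (pp) lp; case/shortenP => q qp uq sb lq.
have sub := uniq_leq_size (proj2 (andP uq)) sb.
exists q; split=> //; apply/eqP; rewrite eqn_leq dist_le// andbT.
by rewrite Ek; rewrite size_tuple in sub.
Qed.

Lemma dist_eq0 (u : G) : dist u u = 0%N.
Proof. by apply/eqP; rewrite -leqn0; exact: (@dist_le u u [::]). Qed.

Lemma dist_triangle (u v w : G) : (dist u w <= dist u v + dist v w)%N.
Proof.
have [p [pp lp _ <-]] := dist_path u v; have [q [qp lq _ <-]] := dist_path v w.
by rewrite -size_cat dist_le// ?cat_path ?pp ?lp ?last_cat ?lp.
Qed.

Lemma dist_sym (u v : G) : dist u v = dist v u.
Proof.
wlog suff H : u v / (dist u v <= dist v u)%N.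
  by apply/eqP; rewrite eqn_leq !H.
have [p [pp lp _ <-]] := dist_path v u.
rewrite -(size_belast v p) -size_rev dist_le ?rev_path// -?lp ?rev_path.
  by rewrite (eq_path (e' := adj)) // => x y; rewrite adj_sym.
by case: p {pp lp} => //= x p; rewrite rev_cons last_rcons.
Qed.

Lemma dist_lt_nvert (u v : G) : (dist u v < nvert G)%N.
Proof.
have [p [_ _ up <-]] := dist_path u v.
by rewrite -[(_ < _)%N]/(size (u :: p) <= _)%N -(card_uniqP up) max_card.
Qed.

Lemma dist_diam (u v : G) : (dist u v <= diam G)%N.
Proof.
apply: leq_trans (leq_bigmax_cond (F := fun v => dist u v) _ (isT : xpredT v)) _.
exact: (leq_bigmax_cond (F := fun u => \max_(v : G) dist u v) _ (isT : xpredT u)).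
Qed.

Lemma dist_closer (u v : G) : u != v -> exists2 w, adj u w & (dist w v < dist u v)%N.
Proof.
have [[|w p] [/= pp lp _ sz]] := dist_path u v; first by rewrite lp eqxx.
case/andP: pp => uw pp _; exists w => //.
by rewrite -sz ltnS dist_le.
Qed.

Lemma diam_lt_nvert : (0 < nvert G)%N -> (diam G < nvert G)%N.
Proof.
move=> n0; rewrite -[ltnRHS](prednK n0) ltnS; apply/bigmax_leqP => u _.
by apply/bigmax_leqP => v _; rewrite -ltnS prednK// dist_lt_nvert.
Qed.

Hypothesis nvert_gt1 : (1 < nvert G)%N.

Lemma conn_deg_gt0 (u : G) : (0 < deg u)%N.
Proof.
have [v uv] : exists v : G, u != v.
  apply/existsP; apply: contraLR nvert_gt1; rewrite negb_exists -leqNgt => /forallP h.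
  by apply/card_le1_eqP => x y _ _; move: (h x) (h y); rewrite !negbK => /eqP<- /eqP<-.
have [w uw _] := dist_closer uv.
by rewrite /deg; apply/card_gt0P; exists w; rewrite inE.
Qed.

Lemma diam_gt0 : (0 < diam G)%N.
Proof.
have /card_gt0P[u _] : (0 < #|{: G}|)%N by apply: ltn_trans nvert_gt1.
have /card_gt0P[v] := conn_deg_gt0 u; rewrite inE => uv.
apply: leq_trans (dist_diam u v).
have [[|w p] [/= _ lp _ <-]] := dist_path u v => //.
by move: uv; rewrite -lp adj_irr.
Qed.

End Distance.

Section HittingTime.
Variables (R : realType) (G : sgraph).
Hypothesis Gconn : connected_graph G.
Hypothesis nvert_gt1 : (1 < nvert G)%N.
Local Notation step := (step R).
Let deg_gt0 := conn_deg_gt0 Gconn nvert_gt1.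

Let N : R := (nvert G).+1%:R.
Let N0 : 0 < N. Proof. by rewrite ltr0n. Qed.

(* Some neighbour is one step closer to z, and N exceeds every degree, so
   1 - N^-(dist u z) decreases on average. *)
Lemma hit_lyapunov (z : G) : exists L : G -> R, (forall u, 0 <= L u) /\
  forall u, u != z -> 1 + \sum_v step u v * L v <= L u.
Proof.
pose d u := dist u z; pose C := N ^+ (nvert G).+1.
exists (fun u => C * (1 - N ^- d u)); split=> [u|u uz].
  apply: mulr_ge0; first by rewrite exprn_ge0// ltW.
  rewrite subr_ge0 invf_le1 ?exprn_gt0//.
  by rewrite exprn_ege1// ler1n.
have -> : \sum_v step u v * (C * (1 - N ^- d v)) =
    C * (1 - \sum_v step u v * N ^- d v).
  have E : \sum_v step u v * C = C by rewrite -mulr_suml step_sum1 ?mul1r.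
  rewrite mulrBr mulr1 -{2}E mulr_sumr -sumrB.
  by apply: eq_bigr => v _; move: (N ^- _) => x; ring.
have [w uw dw] := dist_closer Gconn uz.
have H1 : (deg u)%:R^-1 * N ^- (d u).-1 <= \sum_v step u v * N ^- d v.
  rewrite (bigD1 w)//=; apply: ler_wpDr.
    by apply: sumr_ge0 => v _; rewrite mulr_ge0 ?step_ge0// invr_ge0 exprn_ge0// ltW.
  rewrite /Defs.step uw ler_wpM2l ?invr_ge0// lef_pV2 ?posrE ?exprn_gt0//.
  by rewrite ler_weXn2l ?ler1n//; rewrite -ltnS prednK//; exact: leq_ltn_trans dw.
have dleN : (deg u < (nvert G).+1)%N by rewrite ltnS max_card.
have d0 : (0 : R) < (deg u)%:R by rewrite ltr0n.
have du : N ^+ d u = N * N ^+ (d u).-1.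
  by rewrite -exprS prednK//; exact: leq_ltn_trans dw.
(* [C] outweighs the denominator [deg u * N ^+ d u], since [deg u] is at most [N] and [d u] at most
   [nvert G]; the numerator [N - deg u] is at least 1. *)
have H2 : 1 <= C * ((deg u)%:R^-1 * N ^- (d u).-1 - N ^- d u).
  have -> : (deg u)%:R^-1 * N ^- (d u).-1 - N ^- d u =
      (N - (deg u)%:R) / ((deg u)%:R * N ^+ d u).
    rewrite du; field; rewrite ?mulf_neq0 ?expf_neq0 ?gt_eqF//.
  rewrite mulrA ler_pdivlMr ?mulr_gt0 ?exprn_gt0// mul1r.
  apply: (@le_trans _ _ C); last first.
    apply: ler_peMr; first by rewrite exprn_ge0 ?ltW.
    by rewrite lerBrDr /N -natr1 addrC lerD2r ler_nat -ltnS.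
  rewrite /C exprS; apply: ler_pM => //.
  - by rewrite exprn_ge0 ?ltW.
  - by rewrite ler_nat ltnW.
  - by rewrite ler_weXn2l ?ler1n// ltnW// dist_lt_nvert.
have C0 : 0 <= C by rewrite exprn_ge0 ?ltW.
have := ler_wpM2l C0 H1; move: H2; rewrite !mulrBr mulr1.
by move: (C * \sum_v _) => x; lra.
Qed.

(** [h u] is the expected total of [b] collected on the way from u to z. With [b] constant 1 it is
    the hitting time, with [b] the indicator of S the time spent in S. A bound of [b] times the
    Lyapunov function is the supersolution. *)
Lemma hit_exists (z : G) (b : G -> R) : (forall u, 0 <= b u) ->
  exists h : G -> R, [/\ forall u, 0 <= h u, h z = 0 &
    forall u, u != z -> h u = b u + \sum_v step u v * h v].
Proof.
move=> b0; have [L [L0 LS]] := hit_lyapunov z.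
pose B := \sum_u b u.
have bB u : b u <= B by rewrite /B (bigD1 u)//= lerDl sumr_ge0.
have B0 : 0 <= B by apply: sumr_ge0.
have [||h [h0 hz hS]] := @value_exists R G deg_gt0 G id (fun _ v => v) (pred1 z) b
    (fun u => B * L u) b0.
- by move=> u; rewrite mulr_ge0.
- move=> u uz; rewrite meanZ; apply: le_trans (_ : B * (1 + \sum_v step u v * L v) <= _).
    by rewrite mulrDr mulr1 lerD2r.
  by rewrite ler_wpM2l// LS.
exists h; split=> // [u|]; first by case/andP: (h0 u).
by apply: hz; rewrite /= eqxx.
Qed.

End HittingTime.

(** * Cover and blanket times *)

Section Values.
Variables (R : realType) (G : sgraph).
Hypothesis Gconn : connected_graph G.
Hypothesis nvert_gt1 : (1 < nvert G)%N.
Local Notation step := (step R).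
Let deg_gt0 := conn_deg_gt0 Gconn nvert_gt1.

Definition cover_state_upd (s : G * {set G}) (v : G) : G * {set G} := (v, v |: s.2).

(** [e u V] is the expected remaining cover time of a walk at u when V has been visited already; [C]
    provides the boundedness that minimum principles require. *)
Definition cover_value (e : G -> {set G} -> R) (C : R) :=
  [/\ forall u V, 0 <= e u V <= C,
      forall u, e u [set: G] = 0,
      forall u V, V != [set: G] -> e u V = 1 + \sum_v step u v * e v (v |: V) &
      forall u, COV_from R u = (e u [set u])%:E].

(** [h z] is the hitting time of z and [hp z] the time of the first visit at a positive time; they
    differ only at z. The latter satisfies the first-step equation at z too. *)
Lemma return_time_exists : exists h hp : G -> G -> R,
  [/\ forall z u, 0 <= h z u, forall z, h z z = 0,
      forall z u, u != z -> hp z u = h z u,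
      forall z u, 0 <= hp z u &
      forall z u, hp z u = 1 + \sum_v step u v * h z v].
Proof.
have /choice[h hP] (z : G) := hit_exists Gconn nvert_gt1 z (fun _ : G => @ler01 R).
exists h, (fun z u => 1 + \sum_v step u v * h z v).
have h0 z u : 0 <= h z u by have [] := hP z.
split=> //.
- by move=> z; have [] := hP z.
- by move=> z u uz; have [_ _ ->] := hP z.
- by move=> z u; rewrite addr_ge0// sumr_ge0// => v _; rewrite mulr_ge0 ?step_ge0.
Qed.

(** The supersolution sums [hp z] over the unvisited z: every summand drops by 1 on average, and it
    disappears when z is visited. Using [hp] rather than [h] also covers states whose current vertex
    is not in the visited set. *)
Lemma cover_value_exists : exists e C, cover_value e C.
Proof.
have [h [hp [h0 hz hph hp0 hpS]]] := return_time_exists.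
pose t z (s : G * {set G}) := if z \in s.2 then 0 else hp z s.1.
have t0 z s : 0 <= t z s by rewrite /t; case: ifP.
pose L s := \sum_z t z s.
have tS z (s : G * {set G}) : z \notin s.2 -> 1 + mean fst cover_state_upd (t z) s <= t z s.
  move=> zs; rewrite /t (negbTE zs) hpS lerD2l; apply: ler_sum => v _.
  rewrite ler_wpM2l ?step_ge0//= !inE (negbTE zs) orbF eq_sym.
  by case: eqP => [->|/eqP vz]; rewrite ?hz// hph.
have tS' z (s : G * {set G}) : mean fst cover_state_upd (t z) s <= t z s.
  have [zs|zs] := boolP (z \in s.2); last first.
    by apply: le_trans (tS _ _ zs); rewrite lerDr.
  rewrite {2}/t zs -(mean_cst deg_gt0 fst cover_state_upd 0 s).
  by apply: mean_le => v _; rewrite /t !inE zs orbT.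
have [|||e [eL e0 eS]] := @value_exists R G deg_gt0 _ fst cover_state_upd
  (fun s => s.2 == [set: G]) (fun=> 1) L.
- by move=> s; rewrite ler01.
- by move=> s; apply: sumr_ge0.
- move=> s sT; have [z zs] : exists z, z \notin s.2.
    apply/existsP; rewrite -negb_forall; apply: contra sT => /forallP h'.
    by apply/eqP/setP => z; rewrite h' inE.
  rewrite /L mean_sum (bigD1 z)//= [leRHS](bigD1 z)//= addrA lerD ?tS//.
  by apply: ler_sum.
have bnd u V : 0 <= e (u, V) <= \sum_u \sum_z hp z u.
  have /andP[-> /le_trans->]// := eL (u, V).
  rewrite [leRHS](bigD1 u)//= -[leLHS]addr0; apply: lerD; last first.
    by apply: sumr_ge0 => w _; apply: sumr_ge0.
  by apply: ler_sum => z _; rewrite /t; case: ifP.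
exists (fun u V => e (u, V)), (\sum_u \sum_z hp z u); split=> //.
- by move=> u; apply: e0 => /=.
- by move=> u V VT; rewrite eS.
- move=> u; pose W p := e (last u p, [set x in u :: p]).
  have -> : e (u, [set u]) = W [::] by congr (e (_, _)); apply/setP => x; rewrite !inE.
  have cov p : covers (u :: p) = ([set x in u :: p] == [set: G]).
    apply/forallP/eqP => [H|H v]; first by apply/setP => v; rewrite !inE; apply: H.
    by move/setP/(_ v): H; rewrite !inE.
  rewrite /COV_from; apply: (@expected_stopE R G deg_gt0 (@covers G) u W (\sum_u \sum_z hp z u)).
  + by move=> p; exact: bnd.
  + by move=> p; rewrite cov => H; rewrite /W e0.
  + move=> p; rewrite cov => H; rewrite /W eS//=; congr (1 + _).
    apply: eq_bigr => v _; congr (_ * e (_, _)); first by rewrite last_rcons.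
    by apply/setP => x; rewrite !inE mem_rcons !inE orbCA.
Qed.

(** A vertex below its threshold contributes its return time plus [C] for every further visit it may
    need, up to [K]. Each visit releases one [C], which pays for the next return time. *)
Lemma count_value_exists (thr : G -> nat -> bool) (K : nat) (u : G) :
  (forall v m n, (m <= n)%N -> thr v m -> thr v n) -> (forall v, thr v K) ->
  exists W : seq G -> R, exists C, [/\ forall p, 0 <= W p <= C,
    forall p, [forall v, thr v (count_mem v (u :: p))] -> W p = 0 &
    forall p, ~~ [forall v, thr v (count_mem v (u :: p))] ->
      W p = 1 + mean (last u) (@rcons G) W p].
Proof.
move=> thr_mono thrK.
have [h [hp [h0 hz hph hp0 hpS]]] := return_time_exists.
pose C := \sum_u \sum_z hp z u.
have hpC z w : hp z w <= C.
  rewrite /C (bigD1 w)//= (bigD1 z)//= -addrA lerDl addr_ge0 ?sumr_ge0// => i _.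
  by apply: sumr_ge0.
have C0 : 0 <= C by apply: sumr_ge0 => i _; apply: sumr_ge0.
pose c v p := count_mem v (u :: p).
have cK v p : ~~ thr v (c v p) -> (c v p < K)%N.
  by move=> H; rewrite ltnNge; apply: contra H => H; apply: thr_mono H _.
have cK' z p : ~~ thr z (c z p).+1 -> ((c z p).+1 < K)%N.
  by move=> H; rewrite ltnNge; apply: contra H => H; apply: thr_mono H _.
pose t z p := if thr z (c z p) then 0 else
  hp z (last u p) + C * (K - (c z p).+1)%:R.
have t0 z p : 0 <= t z p.
  by rewrite /t; case: ifP => // _; rewrite addr_ge0// mulr_ge0.
have cS z p v : c z (rcons p v) = (c z p + (v == z))%N.
  by rewrite /c -rcons_cons -cats1 count_cat /= addn0.
have tS z p : ~~ thr z (c z p) -> 1 + mean (last u) (@rcons G) (t z) p <= t z p.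
  move=> zp; rewrite {2}/t (negbTE zp) hpS -addrA lerD2l.
  set D := C * _.
  have -> : \sum_v step (last u p) v * h z v + D =
      \sum_v step (last u p) v * (h z v + D).
    under [RHS]eq_bigr do rewrite mulrDr.
    by rewrite big_split /= -mulr_suml step_sum1 ?mul1r.
  apply: ler_sum => v _; rewrite ler_wpM2l ?step_ge0// /t cS last_rcons.
  have D0 : 0 <= D by rewrite mulr_ge0.
  have [->|vz] := eqVneq v z; last by rewrite addn0 (negbTE zp) hph.
  rewrite addn1 hz add0r; case: ifPn => // H.
  by rewrite /D -(subnSK (cK' _ _ H)) -natr1 mulrDr mulr1 addrC lerD2l.
have tS' z p : mean (last u) (@rcons G) (t z) p <= t z p.
  have [zp|zp] := boolP (thr z (c z p)); last first.
    by apply: le_trans (tS _ _ zp); rewrite lerDr.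
  rewrite {2}/t zp -(mean_cst deg_gt0 (last u) (@rcons G) 0 p).
  apply: mean_le => v _; rewrite /t cS (thr_mono _ _ _ _ zp)//.
  exact: leq_addr.
have [|||W [WL W0 WS]] := @value_exists R G deg_gt0 _ (last u) (@rcons G)
  (fun p => [forall v, thr v (c v p)]) (fun=> 1) (fun p => \sum_z t z p).
- by move=> s; rewrite ler01.
- by move=> s; apply: sumr_ge0.
- move=> p; rewrite negb_forall => /existsP[z zp].
  rewrite mean_sum (bigD1 z)//= [leRHS](bigD1 z)//= addrA lerD ?tS//.
  by apply: ler_sum.
exists W, (\sum_(z : G) (C + C * K%:R)); split=> // p.
have /andP[-> /le_trans->]// := WL p.
apply: ler_sum => z _; rewrite /t; case: ifP => _.
  by rewrite addr_ge0// mulr_ge0.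
by rewrite lerD// ler_wpM2l// ler_nat leq_subr.
Qed.

End Values.

(** * Lazy projections and the lower bound *)

Section LazyProjection.
Variables (R : realType) (F H : sgraph).
Hypotheses (Fconn : connected_graph F) (Fgt1 : (1 < nvert F)%N).
Let Fdeg := conn_deg_gt0 Fconn Fgt1.
Variables (f : F -> H) (q : F -> R).

(* The image of the walk on F stands still with probability 1 - q u and
   otherwise makes a step of the walk on H. *)
Definition lazy_proj := forall (u : F) (phi : H -> R),
  \sum_v step R u v * phi (f v) =
  (1 - q u) * phi (f u) + q u * \sum_y step R (f u) y * phi y.

Hypothesis fq : lazy_proj.
Hypothesis fsurj : forall x, exists u, f u = x.

Variables (eF : F -> {set F} -> R) (CF : R) (eH : H -> {set H} -> R) (CH : R).
Hypotheses (eFP : cover_value eF CF) (eHP : cover_value eH CH).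

Lemma imset_full (V : {set F}) : V = [set: F] -> f @: V = [set: H].
Proof.
by move=> ->; apply/setP => x; rewrite inE; have [u <-] := fsurj x; rewrite imset_f ?inE.
Qed.

(** In one step [c * eH] drops on average by [c * q], which is at most 1, whereas [eF] drops by
    exactly 1; and once F is covered, so is H. *)
Lemma cover_lower (c : R) : 0 <= c -> (forall u, c * q u <= 1) ->
  forall u (V : {set F}), u \in V -> c * eH (f u) (f @: V) <= eF u V.
Proof.
move=> c0 cq u V uV.
have [bF eF0 eFS _] := eFP; have [bH eH0 eHS _] := eHP.
rewrite -subr_ge0.
apply: (@min_principle R F Fdeg _ fst (@cover_state_upd F)
  (fun s => s.1 \in s.2) (fun s => s.2 == [set: F])
  (fun s => eF s.1 s.2 - c * eH (f s.1) (f @: s.2)) (fun s => eF s.1 s.2)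
  (c * CH) _ _ _ _ _ _ (u, V)) => //=.
- by move=> s v _ _ _; rewrite !inE eqxx.
- by move=> s _; case/andP: (bF s.1 s.2).
- by move=> s _ VT; rewrite (eFS _ _ VT) /mean /=.
- move=> s _; have /andP[H0 _] := bF s.1 s.2; have /andP[_ H1] := bH (f s.1) (f @: s.2).
  by have := ler_wpM2l c0 H1; lra.
- by move=> s _ /eqP E; rewrite (imset_full E) eH0 mulr0 subr0 E eF0.
- move=> [v W] /= vW WT; rewrite meanB meanZ /mean /= [in leRHS](eFS _ _ WT).
  have fvW : f v \in f @: W by apply: imset_f.
  under [X in c * X]eq_bigr do rewrite imsetU1.
  rewrite (fq v (fun y => eH y (y |: f @: W))) (finset.setUidPr _); last by rewrite finset.sub1set.
  have := cq v; set X := \sum_v0 step R v v0 * _.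
  (* The image may cover H before the walk covers F; then [eH] stays 0. *)
  have [E|N] := eqVneq (f @: W) [set: H].
    rewrite E eH0; under eq_bigr => y _ do rewrite finset.setUT eH0 mulr0.
    by rewrite big1_eq !mulr0 addr0 mulr0; lra.
  rewrite (eHS _ _ N); set S := \sum_y _ => cqv.
  have -> : X - c * ((1 - q v) * (1 + S) + q v * S) = X - c * (1 + S) + c * q v.
    by ring.
  by lra.
Qed.

End LazyProjection.

(** * Energy and time spent in a set before covering it *)

Section Energy.
Variables (R : realType) (G : sgraph).

(** Every edge is counted twice, once for each orientation. *)
Definition energy (f : G -> R) : R := \sum_u \sum_(v | adj u v) (f u - f v) ^+ 2.

Definition vol (S : {set G}) : R := \sum_(u in S) (deg u)%:R.

Lemma energy_ge0 f : 0 <= energy f.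
Proof. by apply: sumr_ge0 => u _; apply: sumr_ge0 => v _; rewrite sqr_ge0. Qed.

Lemma vol_ge0 S : 0 <= vol S.
Proof. exact: sumr_ge0. Qed.

Hypothesis Gconn : connected_graph G.
Hypothesis nvert_gt1 : (1 < nvert G)%N.
Local Notation step := (step R).
Let deg_gt0 := conn_deg_gt0 Gconn nvert_gt1.

(** Green's formula; the factor 2 reflects the two orientations of an edge. *)
Lemma energy_laplacian f :
  energy f = 2 * \sum_u (deg u)%:R * f u * (f u - \sum_v step u v * f v).
Proof.
have E u : \sum_(v | adj u v) (f u - f v) ^+ 2 =
    (deg u)%:R * f u ^+ 2 + \sum_(v | adj u v) f v ^+ 2
    - 2 * (f u * \sum_(v | adj u v) f v).
  rewrite !mulr_sumr /deg cardsE -sum1_card natr_sum mulr_suml -big_split -sumrB /=.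
  by apply: eq_bigr => v _; ring.
rewrite /energy (eq_bigr _ (fun u _ => E u)) sumrB big_split /=.
have -> : \sum_u \sum_(v | adj u v) f v ^+ 2 = \sum_u (deg u)%:R * f u ^+ 2.
  rewrite (exchange_big_dep xpredT)//=; apply: eq_bigr => v _.
  rewrite sumr_const -[LHS]mulr_natl; congr (_%:R * _).
  by rewrite /deg cardsE; apply: eq_card => w; exact: adj_sym.
rewrite mulr_sumr -big_split -sumrB /=; apply: eq_bigr => u _; rewrite sum_step; field.
by rewrite pnatr_eq0 -lt0n.
Qed.

Lemma sqr_le_cancel (x y : R) : 0 <= x -> 0 <= y -> x ^+ 2 <= y * x -> x <= y.
Proof.
rewrite le_eqVlt => /predU1P[<-//|x0] _.
by rewrite expr2 ler_pM2r.
Qed.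

(* Pairing h with its Laplacian, energy h is at most 2 (max h) vol S; as the
   oscillation of h on S is controlled by its energy, max h cancels. *)
Lemma hit_bound (S : {set G}) (z : G) (rho : R) (h : G -> R) :
  z \in S -> 0 <= rho ->
  (forall a (f : G -> R), a \in S -> (f a - f z) ^+ 2 <= rho * energy f) ->
  (forall u, 0 <= h u) -> h z = 0 ->
  (forall u, u != z -> h u = (u \in S)%:R + \sum_v step u v * h v) ->
  forall u, h u <= 2 * rho * vol S.
Proof.
move=> zS rho0 osc h0 hz hS.
have B0 : 0 <= 2 * rho * vol S by rewrite !mulr_ge0 ?vol_ge0.
have onS u : u \in S -> h u <= 2 * rho * vol S.
  move=> uS; have := zS.
  case/(@Order.TotalTheory.arg_maxP _ _ _ z (mem S) h) => a aS amax.
  apply: le_trans (amax u uS) _; apply: sqr_le_cancel => //.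
  have := osc a h aS; rewrite hz subr0 => /le_trans; apply.
  have -> : 2 * rho * vol S * h a = rho * (2 * (h a * vol S)) by ring.
  rewrite energy_laplacian ler_wpM2l// ler_pM2l ?ltr0n//.
  rewrite /vol mulr_sumr [leRHS]big_mkcond /=.
  apply: ler_sum => u' _; have [->|/hS E] := eqVneq u' z.
    by rewrite hz mulr0 mul0r zS mulr_ge0.
  rewrite {2}E addrK; case: ifPn => [uS'|_]; last by rewrite mulr0.
  by rewrite mulr1 mulrC ler_wpM2r//; exact: amax.
(* Outside S the function [h] is harmonic, so the bound on S extends by the minimum principle. *)
have [L [L0 LS]] := hit_lyapunov R Gconn nvert_gt1 z.
move=> u; rewrite -subr_ge0.
apply: (@min_principle R G deg_gt0 G id (fun _ v => v) (fun=> True) (mem S)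
  (fun u => 2 * rho * vol S - h u) L (\sum_u h u)) => //.
- by move=> v _ vS; apply: LS; apply: contraNneq vS => ->.
- move=> v _; rewrite -[leLHS]add0r lerD// lerN2 (bigD1 v)//= lerDl.
  exact: sumr_ge0.
- by move=> v _ vS; rewrite subr_ge0 onS.
- move=> v _ vS; rewrite meanB mean_cst// lerD2l lerN2 hS.
    by rewrite (negbTE (vS : v \notin S)) add0r.
  by apply: contraNneq vS => ->.
Qed.

End Energy.

(** * Matthews' bound as a potential *)

Section CoverPotential.
Variables (R : realType) (G : sgraph).
Hypothesis Gconn : connected_graph G.
Hypothesis nvert_gt1 : (1 < nvert G)%N.
Local Notation step := (step R).
Let deg_gt0 := conn_deg_gt0 Gconn nvert_gt1.
Variables (S : {set G}) (h : G -> G -> R) (B : R).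
Hypothesis B0 : 0 < B.
Hypothesis h0 : forall z u, 0 <= h z u.
Hypothesis hB : forall z u, z \in S -> h z u <= B.
Hypothesis hS : forall z u, u != z ->
  h z u = (u \in S)%:R + \sum_v step u v * h z v.

Let psi (u : G) (V : {set G}) := \sum_(z in S :\: V) (B + h z u).

(* Dominates the expected time spent in S until S has been visited entirely,
   with Matthews' logarithmic factor: psi contracts by a factor 1 - 1 / (2 B)
   at each visit to S, hence its logarithm decreases by 1 / (2 B). *)
Definition cover_potential (u : G) (V : {set G}) : R :=
  if S \subset V then 0 else 2 * B * (1 + ln (psi u V / B)).

Let psi_lb u (V : {set G}) : ~~ (S \subset V) -> B <= psi u V.
Proof.
move=> /subsetPn[z zS zV]; rewrite /psi (bigD1 z) ?inE ?zS ?zV//= -addrA lerDl.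
by rewrite addr_ge0// sumr_ge0// => i _; rewrite addr_ge0 ?(ltW B0).
Qed.

Let psi_ub u (V : {set G}) : psi u V <= 2 * B * #|S :\: V|%:R.
Proof.
rewrite mulr_natr -sumr_const; apply: ler_sum => z; rewrite inE => /andP[_ zS].
by have := hB u zS; lra.
Qed.

Let psi_ge0 u V : 0 <= psi u V.
Proof. by apply: sumr_ge0 => i _; rewrite addr_ge0 ?(ltW B0). Qed.

Lemma cover_potential_lb u (V : {set G}) : ~~ (S \subset V) -> 2 * B <= cover_potential u V.
Proof.
move=> SV; rewrite /cover_potential (negbTE SV) ler_peMr ?mulr_ge0 ?(ltW B0)//.
by rewrite lerDl ln_ge0// ler_pdivlMr// mul1r psi_lb.
Qed.

Lemma cover_potential_ge0 u V : 0 <= cover_potential u V.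
Proof.
have [SV|SV] := boolP (S \subset V); first by rewrite /cover_potential SV.
by apply: le_trans (cover_potential_lb u SV); rewrite mulr_ge0 ?(ltW B0).
Qed.

Lemma cover_potential_full u (V : {set G}) : S \subset V -> cover_potential u V = 0.
Proof. by rewrite /cover_potential => ->. Qed.

Lemma cover_potential_ub u V (n : nat) : (0 < n)%N -> (#|S| <= n)%N ->
  cover_potential u V <= 2 * B * (1 + ln (2 * n%:R)).
Proof.
move=> n0 Sn; rewrite /cover_potential.
have n2 : 1 <= 2 * n%:R :> R by rewrite -natrM ler1n muln_gt0.
case: ifPn => SV.
  by rewrite !mulr_ge0 ?(ltW B0)// addr_ge0// ln_ge0.
rewrite ler_wpM2l ?mulr_ge0 ?(ltW B0)// lerD2l ler_ln ?posrE.
- rewrite ler_pdivrMr// (le_trans (psi_ub _ _))// mulrAC ler_wpM2r ?(ltW B0)//.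
  by rewrite ler_wpM2l// ler_nat (leq_trans (subset_leq_card (subsetDl _ _))).
- by rewrite divr_gt0// (lt_le_trans B0)// psi_lb.
- by rewrite (lt_le_trans _ n2).
Qed.

Let ln_le_sub1 (x : R) : 0 < x -> 1 + ln x <= x.
Proof.
move=> x0; have := @le_ln1Dx R (x - 1); rewrite subrKC => H.
have /H : -1 < x - 1 by rewrite ltrBrDl subrr.
by rewrite lerBrDl.
Qed.

(** An unvisited z differs from u, so each summand obeys its hitting equation; vertices visited by
    the step only drop out of the sum. *)
Let psi_step (u : G) (V : {set G}) : u \in V ->
  \sum_v step u v * psi v (v |: V) <= psi u V - #|S :\: V|%:R * (u \in S)%:R.
Proof.
move=> uV.
apply: (@le_trans _ _ (\sum_v step u v * psi v V)).
  apply: ler_sum => v _; rewrite ler_wpM2l ?step_ge0//.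
  rewrite /psi [leRHS](big_setID (S :\: (v |: V))) /=.
  rewrite (finset.setIidPr _) ?lerDl.
    by apply: sumr_ge0 => z _; rewrite addr_ge0 ?(ltW B0).
  by rewrite finset.setDS// finset.subsetUr.
rewrite mulr_natl -sumr_const /psi -sumrB.
under eq_bigr do rewrite mulr_sumr.
rewrite exchange_big /=; apply: ler_sum => z; rewrite inE => /andP[zV _].
have uz : u != z by apply: contraNneq zV => <-.
under eq_bigr do rewrite mulrDr.
rewrite big_split /= -mulr_suml step_sum1// mul1r (hS uz).
by move: (\sum_v _) (_%:R) => x y; lra.
Qed.

Lemma cover_potential_step (u : G) (V : {set G}) : u \in V -> ~~ (S \subset V) ->
  (u \in S)%:R + \sum_v step u v * cover_potential v (v |: V) <= cover_potential u V.
Proof.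
move=> uV SV; set P := psi u V.
have BP : B <= P by exact: psi_lb.
have P0 : 0 < P by apply: lt_le_trans BP.
have lnP : 0 <= ln (P / B) by rewrite ln_ge0// ler_pdivlMr// mul1r.
(* The logarithm is linearised at [P] by 1 + ln x <= x. A step that completes the cover gives
   potential 0, which obeys the same bound. *)
have H v : cover_potential v (v |: V) <= 2 * B * (psi v (v |: V) / P + ln (P / B)).
  rewrite /cover_potential; case: ifPn => [_|nS].
    by rewrite !mulr_ge0 ?(ltW B0)// addr_ge0// divr_ge0// ltW.
  rewrite ler_wpM2l ?mulr_ge0 ?(ltW B0)//.
  have Q0 : 0 < psi v (v |: V) by apply: lt_le_trans (psi_lb _ nS).
  have -> : psi v (v |: V) / B = psi v (v |: V) / P * (P / B).
    by rewrite mulrA divfK// gt_eqF.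
  by rewrite lnM ?posrE ?divr_gt0// addrA lerD2r ln_le_sub1// divr_gt0.
have : \sum_v step u v * cover_potential v (v |: V) <=
    2 * B * ((\sum_v step u v * psi v (v |: V)) / P + ln (P / B)).
  apply: le_trans (_ : \sum_v step u v * (2 * B * (psi v (v |: V) / P + ln (P / B))) <= _).
    by apply: ler_sum => v _; rewrite ler_wpM2l ?step_ge0.
  have E : \sum_v step u v * ln (P / B) = ln (P / B).
    by rewrite -mulr_suml step_sum1// mul1r.
  rewrite -{2}E mulr_suml -big_split mulr_sumr /=; apply: ler_sum => v _.
  by rewrite le_eqVlt; apply/orP; left; apply/eqP; ring.
move=> /(lerD (lexx (u \in S)%:R)) /le_trans; apply.
have -> : cover_potential u V = 2 * B * (1 + ln (P / B)).
  by rewrite /cover_potential (negbTE SV).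
have PN : P != 0 by rewrite gt_eqF.
have := psi_step uV; rewrite -/P; set X := \sum_v _; set k : R := #|_|%:R; set t : R := (u \in S)%:R => H1.
(* Each unvisited vertex weighs at most [2 * B] in psi, so at a vertex of S the decrease [k] is at
   least [P / (2 * B)]. *)
have k1 : P <= 2 * B * k by exact: psi_ub.
have H2 : (t * P + 2 * B * X) / P <= 2 * B.
  rewrite ler_pdivrMr//; have := ler_wpM2l (mulr_ge0 (ler0n R 2) (ltW B0)) H1.
  have := ler_wpM2r (ler0n R (u \in S)) k1; rewrite -/t; lra.
rewrite mulrDl mulfK// -mulrA in H2; rewrite !mulrDr mulr1.
by move: (X / P) H2 => y; lra.
Qed.

End CoverPotential.

(** * Detours *)

Section Detour.
Variables (R : realType) (G : sgraph).
Hypothesis Gconn : connected_graph G.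
Hypothesis nvert_gt1 : (1 < nvert G)%N.
Local Notation step := (step R).
Let deg_gt0 := conn_deg_gt0 Gconn nvert_gt1.

(** The degrees form an invariant measure, by symmetry of adjacency. *)
Lemma sum_deg_step (f : G -> R) :
  \sum_u (deg u)%:R * (\sum_v step u v * f v) = \sum_u (deg u)%:R * f u.
Proof.
have E u : (deg u)%:R * (\sum_v step u v * f v) = \sum_(v | adj u v) f v.
  by rewrite sum_step mulVKf// pnatr_eq0 -lt0n.
rewrite (eq_bigr _ (fun u _ => E u)) (exchange_big_dep xpredT)//=.
apply: eq_bigr => v _; rewrite sumr_const -[LHS]mulr_natl; congr (_%:R * _).
by rewrite /deg cardsE; apply: eq_card => w; exact: adj_sym.
Qed.

(* A function b of mean zero for the stationary distribution is a discrete
   Laplacian; here b = 1 - mu 1_S. *)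
Lemma poisson_exists (S : {set G}) (mu : R) : S != finset.set0 ->
  mu * vol R S = 2 * (nedge G)%:R ->
  exists g : G -> R, forall u, g u = 1 - mu * (u \in S)%:R + \sum_v step u v * g v.
Proof.
move=> /set0Pn[z zS] muE.
have [h [_ _ hS]] := hit_exists Gconn nvert_gt1 z (fun _ : G => @ler01 R).
have [k [_ _ kS]] := hit_exists Gconn nvert_gt1 z (fun u : G => @ler0n R (u \in S)).
pose g u := h u - mu * k u.
(* The residual [r] vanishes off z. Its sum weighted by degrees is 0, by invariance and the choice
   of [mu], so it vanishes at z as well. *)
pose r u := g u - (1 - mu * (u \in S)%:R + \sum_v step u v * g v).
have gS u : \sum_v step u v * g v = \sum_v step u v * h v - mu * \sum_v step u v * k v.
  by rewrite mulr_sumr -sumrB; apply: eq_bigr => v _; rewrite /g; ring.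
have r0 u : u != z -> r u = 0.
  move=> uz; rewrite /r gS {1}/g {1}(hS u uz) {1}(kS u uz).
  by move: (\sum_v _) (\sum_v _) => x y; ring.
have : \sum_u (deg u)%:R * r u = 0.
  have E u : (deg u)%:R * r u = (deg u)%:R * g u -
      (deg u)%:R * (\sum_v step u v * g v) -
      (deg u)%:R + mu * ((deg u)%:R * (u \in S)%:R).
    by rewrite /r; move: (\sum_v _) => x; ring.
  rewrite (eq_bigr _ (fun u _ => E u)) big_split /= !sumrB sum_deg_step subrr sub0r.
  rewrite -mulr_sumr -natr_sum handshake natrM -muE addrC; apply/eqP; rewrite subr_eq0.
  apply/eqP; congr (mu * _); rewrite /vol [RHS]big_mkcond; apply: eq_bigr => u _.
  by case: ifP; rewrite ?mulr1 ?mulr0.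
rewrite (bigD1 z)//= big1 => [/eqP|u uz]; last by rewrite r0 ?mulr0.
rewrite addr0 mulf_eq0 pnatr_eq0 -leqn0 leqNgt deg_gt0 /= => /eqP rz.
exists g => u; apply/eqP; rewrite -subr_eq0; apply/eqP.
by have [->|/r0] := eqVneq u z.
Qed.

Variables (e : G -> {set G} -> R) (C : R).
Hypothesis eP : cover_value e C.

Let e0 u V : 0 <= e u V. Proof. by have [/(_ u V)/andP[]] := eP. Qed.
Let eC u V : e u V <= C. Proof. by have [/(_ u V)/andP[]] := eP. Qed.
Let C0 (u : G) : 0 <= C. Proof. exact: le_trans (e0 u finset.set0) (eC _ _). Qed.

Lemma cover_value_step u V : e u V <= 1 + \sum_v step u v * e v (v |: V).
Proof.
have [_ eT eS _] := eP.
have [->|/eS -> //] := eqVneq V [set: G].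
by rewrite eT addr_ge0// sumr_ge0// => v _; rewrite mulr_ge0 ?step_ge0.
Qed.

(** A single walk carries both visited sets, which stay nested; both values lose 1 per step until
    the larger set is full. *)
Lemma cover_value_mono u (V W : {set G}) : V \subset W -> e u W <= e u V.
Proof.
have [_ eT eS _] := eP => VW; rewrite -subr_ge0.
pose upd (s : G * ({set G} * {set G})) (v : G) := (v, (v |: s.2.1, v |: s.2.2)).
apply: (@min_principle R G deg_gt0 _ fst upd
  (fun s => s.2.1 \subset s.2.2) (fun s => s.2.2 == [set: G])
  (fun s => e s.1 s.2.1 - e s.1 s.2.2) (fun s => e s.1 s.2.2) C
  _ _ _ _ _ _ (u, (V, W))) => //=.
- by move=> s v sub _ _; exact: finset.setUS.
- by move=> s _ /eS ->.
- by move=> s _; rewrite -[leLHS]add0r lerD ?lerN2.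
- by move=> s _ /eqP ->; rewrite eT subr0.
- move=> s sub sT; rewrite meanB (eS _ _ sT) eS; last first.
    by apply: contraNneq sT => E; rewrite -finset.subTset -E.
  by rewrite /mean opprD addrACA subrr add0r.
Qed.

(* Visiting S entirely and coming back to z takes at most 2 B (1 + ln (2 n)) + B
   steps in S, B bounding the time in S before hitting a vertex of S. The time
   in S during an excursion from z is vol S / (2 m) of its total length, and
   the Poisson solution g converts one count into the other. *)
Lemma detour (S V : {set G}) (z : G) (rho : R) (n : nat) :
  z \in S -> z \in V -> (#|S| <= n)%N -> 0 < rho ->
  (forall a b (f : G -> R), a \in S -> b \in S -> (f a - f b) ^+ 2 <= rho * energy f) ->
  e z V <= 4 * (nedge G)%:R * rho * (3 + 2 * ln (2 * n%:R)) + e z (V :|: S).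
Proof.
move=> zS zV Sn rho0 osc.
have S0 : S != finset.set0 by apply/set0Pn; exists z.
have vS0 : 0 < vol R S.
  by rewrite /vol (bigD1 z)//= ltr_wpDr ?sumr_ge0// ltr0n.
pose B := 2 * rho * vol R S.
have B0 : 0 < B by rewrite !mulr_gt0.
have /choice[h hP] (w : G) := hit_exists Gconn nvert_gt1 w (fun u : G => @ler0n R (u \in S)).
have h0 w u : 0 <= h w u by have [] := hP w.
have hz w : h w w = 0 by have [] := hP w.
have hS w u : u != w -> h w u = (u \in S)%:R + \sum_v step u v * h w v.
  by have [_ _] := hP w; apply.
have hB w u : w \in S -> h w u <= B.
  move=> wS; apply: (hit_bound Gconn nvert_gt1 wS (ltW rho0)) => //.
    by move=> a f aS; exact: osc.
  by move=> v; exact: hS.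
pose Phi := cover_potential S h B.
have Phi0 u W : 0 <= Phi u W by apply: cover_potential_ge0.
(* Time still to be spent in S: before S is covered, [Phi] plus [B] for the way back to z;
   afterwards, the time in S before hitting z. *)
pose Psi (s : G * {set G}) := if S \subset s.2 then h z s.1 else Phi s.1 s.2 + B.
have Psi0 s : 0 <= Psi s by rewrite /Psi; case: ifP => _ //; rewrite addr_ge0 ?(ltW B0).
pose mu := 2 * (nedge G)%:R / vol R S.
have mu0 : 0 <= mu by rewrite divr_ge0 ?mulr_ge0// ltW.
have muE : mu * vol R S = 2 * (nedge G)%:R by rewrite divfK// gt_eqF.
have [g gS] := poisson_exists S0 muE.
(* Per step [mu * Psi] loses at least [mu] times the indicator of S, and [g] loses 1 minus that
   amount, so [D] loses at least 1. The [g] part is 0 at both ends of the detour, which are at z. *)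
pose D (s : G * {set G}) := mu * Psi s + (g s.1 - g z).
pose A (s : G * {set G}) := (S \subset s.2) && (s.1 == z).
have PsiS (s : G * {set G}) : s.1 \in s.2 -> ~~ A s ->
    (s.1 \in S)%:R + mean fst (@cover_state_upd G) Psi s <= Psi s.
  case: s => u W /= uW; rewrite /A /= => nA.
  have [SW|SW] := boolP (S \subset W).
    rewrite SW /= in nA; rewrite {2}/Psi /= SW (hS _ _ nA) lerD2l.
    apply: ler_sum => v _; rewrite ler_wpM2l ?step_ge0// /Psi /=.
    by rewrite (fintype.subset_trans SW (finset.subsetUr _ _)).
  rewrite {2}/Psi /= (negbTE SW).
  apply: le_trans (_ : (u \in S)%:R +
      (\sum_v step u v * Phi v (v |: W) + B) <= _); last first.
    by rewrite addrA lerD2r; apply: cover_potential_step.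
  rewrite lerD2l -(mean_cst deg_gt0 fst (@cover_state_upd G) B (u, W)).
  rewrite -big_split /=; apply: ler_sum => v _.
  rewrite -mulrDr ler_wpM2l ?step_ge0// /Psi /=.
  by case: ifP => // _; rewrite (le_trans (hB _ _ zS))// lerDr.
have DS (s : G * {set G}) : s.1 \in s.2 -> ~~ A s ->
    1 + mean fst (@cover_state_upd G) D s <= D s.
  move=> sI sA; rewrite meanD meanZ meanB mean_cst//.
  have := ler_wpM2l mu0 (PsiS s sI sA); rewrite mulrDr.
  rewrite /D (gS s.1) /mean /=.
  by move: (\sum_v _) (\sum_v _) (mu * _) (mu * _) => *; lra.
pose M := \sum_u `|g u|.
have gM u : `|g u| <= M by rewrite /M (bigD1 u)//= lerDl sumr_ge0.
have DM s : - (M + M) <= D s.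
  rewrite -[leLHS]add0r; apply: lerD; first by rewrite mulr_ge0.
  rewrite opprD; apply: lerD; first by rewrite lerNl (le_trans (ler_norm _))// normrN.
  by rewrite lerN2 (le_trans (ler_norm _)).
rewrite -subr_ge0.
suff : 0 <= D (z, V) + e z (V :|: S) - e z V.
  move=> H; apply: le_trans H _; rewrite lerD2r lerD2r /D /= subrr addr0.
  have n0 : (0 < n)%N by apply: leq_trans Sn; apply/card_gt0P; exists z.
  have ln0 : 0 <= ln (2 * n%:R) :> R.
    by rewrite ln_ge0// -natrM ler1n muln_gt0.
  apply: le_trans (_ : mu * (2 * B * (1 + ln (2 * n%:R)) + B) <= _).
    rewrite ler_wpM2l// /Psi /=; case: ifP => _.
      rewrite (le_trans (hB _ _ zS))// lerDr; apply: mulr_ge0; last by rewrite addr_ge0.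
      by rewrite mulr_ge0// ltW.
    rewrite lerD2r; apply: cover_potential_ub => //.
  rewrite le_eqVlt; apply/orP; left; apply/eqP.
  have -> : mu * (2 * B * (1 + ln (2 * n%:R)) + B) =
      mu * vol R S * (2 * rho * (3 + 2 * ln (2 * n%:R))).
    by rewrite /B; ring.
  by rewrite muE; ring.
(* During the detour [e] loses at most 1 per step. At its end the walk is back at z and has visited
   at least V and S, so monotonicity concludes. *)
apply: (@min_principle R G deg_gt0 _ fst (@cover_state_upd G)
  (fun s => s.1 \in s.2 /\ V \subset s.2) A
  (fun s => D s + e z (V :|: S) - e s.1 s.2) (fun s => D s + (M + M))
  (M + M + C) _ _ _ _ _ _ (z, V)) => //=.
- move=> s v [_ sub] _ _; split; first by rewrite !inE eqxx.
  exact: fintype.subset_trans sub (finset.subsetUr _ _).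
- by move=> s _; rewrite -lerBlDr sub0r.
- by move=> s [sI _] sA; rewrite meanD mean_cst// addrA lerD2r DS.
- move=> s _; rewrite opprD; apply: lerD; last by rewrite lerN2.
  by apply: le_trans (DM s) _; rewrite lerDl.
- move=> [u W] /= [uW VW] /andP[/= SW /eqP uz].
  rewrite uz /D /Psi /= SW hz mulr0 subrr !add0r subr_ge0.
  by apply: cover_value_mono; rewrite finset.subUset VW.
- move=> s [sI _] sA; rewrite meanB meanD mean_cst//.
  have := DS s sI sA; have := cover_value_step s.1 s.2; rewrite {3}/mean /=.
  by move: (\sum_v _) (mean _ _ _ _) (D s) => *; lra.
Qed.

End Detour.

(** * Covering by blocks *)

Section Blocks.
Variables (R : realType) (F H : sgraph).
Hypotheses (Fconn : connected_graph F) (Fgt1 : (1 < nvert F)%N).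
Let Fdeg := conn_deg_gt0 Fconn Fgt1.
Variables (f : F -> H) (q : F -> R) (c : R).
Hypothesis fq : lazy_proj f q.
Hypothesis c0 : 0 <= c.
Hypothesis cq : forall u, 1 <= c * q u.
Variables (eF : F -> {set F} -> R) (CF : R) (eH : H -> {set H} -> R) (CH : R).
Hypotheses (eFP : cover_value eF CF) (eHP : cover_value eH CH).

Variables (I : finType) (bl : H -> I).
Definition block (k : I) : {set F} := [set u | bl (f u) == k].

Variables (rho : R) (n : nat).
Hypothesis rho1 : 1 <= rho.
Hypothesis osc : forall k a b (phi : F -> R), a \in block k -> b \in block k ->
  (phi a - phi b) ^+ 2 <= rho * energy phi.
Hypothesis block_le : forall k, (#|block k| <= n)%N.

Let rho0 : 0 < rho. Proof. exact: lt_le_trans rho1. Qed.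

Definition detour_cost : R := 4 * (nedge F)%:R * rho * (3 + 2 * ln (2 * n%:R)).

Let n0 (u : F) : (0 < n)%N.
Proof. by apply: leq_trans (block_le (bl (f u))); apply/card_gt0P; exists u; rewrite inE. Qed.

Let lnn (u : F) : 0 <= ln (2 * n%:R) :> R.
Proof. by rewrite ln_ge0// -natrM ler1n muln_gt0/= (n0 u). Qed.

Lemma detour_cost_ge0 (u : F) : 0 <= detour_cost.
Proof. by rewrite /detour_cost !mulr_ge0 ?addr_ge0 ?mulr_ge0 ?(lnn u)// ltW. Qed.

Definition unvisited (V : {set F}) : R := \sum_k (~~ (block k \subset V))%:R.

Lemma unvisited_mono (V W : {set F}) : V \subset W -> unvisited W <= unvisited V.
Proof.
move=> VW; apply: ler_sum => k _; rewrite ler_nat.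
have [kV|_] := boolP (block k \subset V); last by case: (block k \subset W).
by rewrite (fintype.subset_trans kV VW).
Qed.

(** Declaring the block of the current vertex visited is free if it already is; otherwise one detour
    pays for it, and [unvisited] drops by at least 1. *)
Lemma visit_block (u : F) (V : {set F}) : u \in V ->
  eF u V + detour_cost * unvisited (V :|: block (bl (f u))) <=
  detour_cost * unvisited V + eF u (V :|: block (bl (f u))).
Proof.
move=> uV; set k := bl (f u).
have [kV|nkV] := boolP (block k \subset V).
  by rewrite (finset.setUidPl kV) addrC.
have uk : u \in block k by rewrite inE.
have := detour Fconn Fgt1 eFP uk uV (block_le k) rho0 (@osc k).
rewrite -/detour_cost => dt.
have E : unvisited (V :|: block k) + 1 <= unvisited V.
  rewrite /unvisited (bigD1 k)//= finset.subsetUr/= add0r addrC [leRHS](bigD1 k)//= nkV.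
  rewrite lerD2l; apply: ler_sum => j _; rewrite ler_nat.
  have [jV|_] := boolP (block j \subset V); last by case: (_ \subset _).
  by rewrite (fintype.subset_trans jV (finset.subsetUl _ _)).
by have := ler_wpM2l (detour_cost_ge0 u) E; lra.
Qed.

Let lazy_mean (u : F) (phi : H -> R) (a : R) :
  a = 1 + \sum_y step R (f u) y * phi y ->
  c * ((1 - q u) * a + q u * \sum_y step R (f u) y * phi y) <= c * a - 1.
Proof.
move=> aE; have -> : \sum_y step R (f u) y * phi y = a - 1 by rewrite aE addrAC subrr add0r.
have -> : c * ((1 - q u) * a + q u * (a - 1)) = c * a - c * q u by ring.
by have := cq u; lra.
Qed.

(* While the image of the walk covers H anew, every unvisited block is visited
   by a detour from its first entry point; W is the set of vertices of H seen so
   far and V also contains the blocks already treated. *)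
Lemma cover_le_blocks (u : F) (V : {set F}) : u \in V ->
  eF u V <= c * eH (f u) [set f u] + detour_cost * unvisited V.
Proof.
move=> uV.
have [bF eF0 eFS _] := eFP; have [bH eH0 eHS _] := eHP.
have F0 v W : 0 <= eF v W by case/andP: (bF v W).
have FC v W : eF v W <= CF by case/andP: (bF v W).
have H0 v W : 0 <= eH v W by case/andP: (bH v W).
pose upd (s : F * ({set F} * {set H})) (v : F) :=
  (v, ((v |: s.2.1) :|: block (bl (f v)), f v |: s.2.2)).
pose L (s : F * ({set F} * {set H})) := c * eH (f s.1) s.2.2.
pose Inv (s : F * ({set F} * {set H})) := [/\ s.1 \in s.2.1, f s.1 \in s.2.2 &
  forall x, x \in s.2.2 -> block (bl x) \subset s.2.1].
pose A (s : F * ({set F} * {set H})) := s.2.2 == [set: H].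
have LS s : Inv s -> ~~ A s -> 1 + mean fst upd L s <= L s.
  case: s => v [V' W] [/= _ vW _]; rewrite /A /= => WT; rewrite addrC -lerBrDr.
  apply: le_trans (lazy_mean (eHS _ _ WT)); rewrite /L meanZ ler_wpM2l// /mean /=.
  rewrite (fq v (fun y => eH y (y |: W))) (finset.setUidPr _)//.
  by rewrite finset.sub1set.
suff : 0 <= L (u, (V :|: block (bl (f u)), [set f u])) +
    detour_cost * unvisited (V :|: block (bl (f u))) - eF u (V :|: block (bl (f u))).
  by rewrite /L /=; have := visit_block uV; lra.
apply: (@min_principle R F Fdeg _ fst upd Inv A
  (fun s => L s + detour_cost * unvisited s.2.1 - eF s.1 s.2.1) L CF) => //=.
- move=> s v [sI sW sB] _ _; split; rewrite /upd /= ?inE ?eqxx// => x.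
  rewrite !inE => /predU1P[->|/sB h]; first exact: finset.subsetUr.
  apply: fintype.subset_trans h _; rewrite -finset.setUA finset.setUCA.
  exact: finset.subsetUl.
- by move=> s _; rewrite mulr_ge0.
- move=> s _; rewrite -[leLHS]add0r lerD ?lerN2// addr_ge0// mulr_ge0 ?(detour_cost_ge0 u)//.
  exact: sumr_ge0.
- move=> [v [V' W]] [/= _ _ sB] /eqP/= WT.
  have -> : V' = [set: F].
    apply/setP => w; rewrite inE; apply: (fintype.subsetP (sB (f w) _)); last by rewrite inE.
    by rewrite WT inE.
  rewrite eF0 subr0 /L addr_ge0// mulr_ge0// ?(detour_cost_ge0 u)//; exact: sumr_ge0.
- move=> s sI sA; rewrite meanB meanD.
  have := LS s sI sA.
  have := cover_value_step eFP s.1 s.2.1.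
  set T := \sum_v _ => eFs LSs.
  suff : mean fst upd (fun s => detour_cost * unvisited s.2.1) s -
     mean fst upd (fun s => eF s.1 s.2.1) s <= detour_cost * unvisited s.2.1 - T by lra.
  rewrite -[detour_cost * unvisited s.2.1](mean_cst Fdeg fst upd _ s) -meanB /T /mean.
  rewrite -sumrB; apply: ler_sum => v _; rewrite -mulrBr ler_wpM2l ?step_ge0//=.
  have vI : v \in v |: s.2.1 by rewrite !inE eqxx.
  have := visit_block vI.
  have := ler_wpM2l (detour_cost_ge0 u) (unvisited_mono (finset.subsetUr [set v] s.2.1)).
  by lra.
- split; rewrite /= ?inE ?eqxx ?uV// => x; rewrite inE => /eqP ->.
  exact: finset.subsetUr.
Qed.

(** History of the walk on H induced by p: moves at which the image stands still are deleted. *)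
Fixpoint hproj (u : F) (p : seq F) : seq H :=
  if p is v :: p' then
    (if f v == f u then hproj v p' else f v :: hproj v p')
  else [::].

Lemma last_hproj u p : last (f u) (hproj u p) = f (last u p).
Proof. by elim: p u => //= v p IH u; case: eqP => [<-|_] /=. Qed.

Lemma hproj_rcons u p v : hproj u (rcons p v) =
  if f v == f (last u p) then hproj u p else rcons (hproj u p) (f v).
Proof.
elim: p u => [|w p IH] u /=; first by case: eqP.
by rewrite IH; case: (f w == f u); case: (f v == _).
Qed.

Lemma count_hproj (a : pred H) u p :
  (count a (f u :: hproj u p) <= count (a \o f) (u :: p))%N.
Proof.
rewrite /= leq_add2l; elim: p u => //= v p IH u.
by case: eqP => _ /=; rewrite ?leq_add2l ?(leq_trans (IH _))// leq_addl.
Qed.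

End Blocks.

(** * Blanketing first, detours afterwards *)

Section BlanketPhase.
Variables (R : realType) (F H : sgraph).
Hypotheses (Fconn : connected_graph F) (Fgt1 : (1 < nvert F)%N).
Let Fdeg := conn_deg_gt0 Fconn Fgt1.
Variables (f : F -> H) (q : F -> R) (c : R).
Hypothesis fq : lazy_proj f q.
Hypothesis c0 : 0 <= c.
Hypothesis cq : forall u, 1 <= c * q u.
Variables (eF : F -> {set F} -> R) (CF : R) (eH : H -> {set H} -> R) (CH : R).
Hypotheses (eFP : cover_value eF CF) (eHP : cover_value eH CH).


Variables (I : finType) (bl : H -> I).
Local Notation block := (block f bl).

Variables (rho : R) (n : nat).
Hypothesis rho1 : 1 <= rho.
Hypothesis osc : forall k a b (phi : F -> R), a \in block k -> b \in block k ->
  (phi a - phi b) ^+ 2 <= rho * energy phi.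
Hypothesis block_le : forall k, (#|block k| <= n)%N.
Local Notation kappa := (detour_cost F rho n).

Variables (thr : H -> nat -> bool) (t : I -> R).
Hypothesis t_gt0 : forall k, block k != finset.set0 -> 0 < t k.
Hypothesis thr_t : forall (s : seq H) k, (forall x, thr x (count_mem x s)) ->
  t k <= (count (fun x => bl x == k) s)%:R.

Variable covH : R.
Hypothesis eH_le : forall x, eH x [set x] <= covH.

Variables (u : F) (W : seq H -> R) (CW : R).
Let A (s : seq H) := [forall x, thr x (count_mem x (f u :: s))].
Hypothesis W_bound : forall s, 0 <= W s <= CW.
Hypothesis W_stop : forall s, A s -> W s = 0.
Hypothesis W_step : forall s, ~~ A s -> W s = 1 + mean (last (f u)) (@rcons H) W s.

Let rho0 : 0 < rho. Proof. exact: lt_le_trans rho1. Qed.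

(* By Markov's inequality, block k is still unvisited at the blanket time with
   probability at most (expected number of steps in it before it is covered) / t k.
   This is built in the potential by charging kappa / t k for every step in the
   block until it is covered. *)
Lemma cover_le_blanket :
  eF u [set u] <= c * (W [::] + covH) +
    \sum_(k | block k != finset.set0)
      kappa / t k * (4 * rho * vol R (block k) * (1 + ln (2 * n%:R))).
Proof.
have [bF eF0 eFS _] := eFP; have [bH eH0 eHS _] := eHP.
have W0 s : 0 <= W s by case/andP: (W_bound s).
have CH0 : 0 <= covH by apply: le_trans (eH_le (f u)); case/andP: (bH (f u) [set f u]).
have kappa0 : 0 <= kappa := detour_cost_ge0 rho1 block_le u.
pose B k := 2 * rho * vol R (block k).
have /choice[h hP] (kw : I * F) :=
  hit_exists Fconn Fgt1 kw.2 (fun v : F => @ler0n R (v \in block kw.1)).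
have h0 k w v : 0 <= h (k, w) v by have [] := hP (k, w).
have hz k w : h (k, w) w = 0 by have [] := hP (k, w).
have hS k w v : v != w -> h (k, w) v =
    (v \in block k)%:R + \sum_x step R v x * h (k, w) x.
  by have [_ _] := hP (k, w); apply.
have hB k w v : w \in block k -> h (k, w) v <= B k.
  move=> wk; apply: (hit_bound Fconn Fgt1 wk (ltW rho0)) => //.
    by move=> a phi ak; apply: (@osc k).
  by move=> x; exact: hS.
pose P k := block k != finset.set0.
have B1 k : P k -> 1 <= 2 * B k.
  move=> /set0Pn[w wk]; rewrite /B !mulrA -natrM.
  have : 1 <= vol R (block k).
    rewrite /vol (bigD1 w)//= -[leLHS]addr0 lerD ?sumr_ge0//.
    by rewrite ler1n.
  have r1 := rho1; move=> v1.
  have : 1 <= rho * vol R (block k) by rewrite -[leLHS]mulr1 ler_pM.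
  by rewrite -mulrA; lra.
have B0 k : P k -> 0 < B k by move=> /B1; lra.
pose Phi k := cover_potential (block k) (fun w => h (k, w)) (B k).
have Phi0 k v V : P k -> 0 <= Phi k v V by move=> Pk; apply: cover_potential_ge0 => //; exact: B0.
pose vis p := [set x in u :: p].
(* [belast] omits the current vertex: its visit is still accounted for by [Phi]. [Q k] is then a
   supermartingale, which falls to 0 when block k is covered. *)
pose N k p : R := (count (mem (block k)) (belast u p))%:R.
pose Q k p := (if block k \subset vis p then 0 else N k p) + Phi k (last u p) (vis p).
have Q0 k p : P k -> 0 <= Q k p.
  by move=> Pk; rewrite /Q addr_ge0 ?Phi0//; case: ifP.
have visS p v : vis (rcons p v) = v |: vis p.
  by apply/setP => x; rewrite !inE mem_rcons !inE orbCA.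
have last_vis p : last u p \in vis p by rewrite inE mem_last.
have NS k p v : N k (rcons p v) = N k p + (last u p \in block k)%:R.
  by rewrite /N belast_rcons lastI -cats1 count_cat natrD /= addn0.
have QS k p : P k -> mean (last u) (@rcons F) (Q k) p <= Q k p.
  move=> Pk; have [kV|kV] := boolP (block k \subset vis p).
    have E q' : block k \subset vis q' -> Q k q' = 0.
      by move=> kq; rewrite /Q kq /Phi cover_potential_full ?addr0.
    rewrite (E p kV) -(mean_cst Fdeg (last u) (@rcons F) 0 p); apply: mean_le => v _.
    by rewrite E// visS (fintype.subset_trans kV (finset.subsetUr _ _)).
  have St := cover_potential_step Fconn Fgt1 (B0 k Pk) (h0 k) (fun z v => hB k z v)
    (hS k) (last_vis p) kV.
  apply: le_trans (_ : N k p + ((last u p \in block k)%:R +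
    \sum_v step R (last u p) v * Phi k v (v |: vis p)) <= _); last first.
    by rewrite /Q (negbTE kV) lerD2l.
  rewrite addrA -[X in X + _](mean_cst Fdeg (last u) (@rcons F) _ p) -big_split /=.
  apply: ler_sum => v _; rewrite -mulrDr ler_wpM2l ?step_ge0// /Q last_rcons visS lerD2r.
  by case: ifP => _; rewrite ?NS// addr_ge0.
pose hp p := hproj f u p.
pose G p := c * (W (hp p) + covH) + \sum_(k | P k) kappa / t k * Q k p.
(* The image moves with probability [q], and then [W] drops by 1 on average; as [c * q] is at least
   1, so is the mean drop of [c * W]. *)
have WS p : ~~ A (hp p) ->
   1 + mean (last u) (@rcons F) (fun p => c * W (hp p)) p <= c * W (hp p).
  move=> nA; rewrite meanZ {1}/mean.
  pose phi y := if y == f (last u p) then W (hp p) else W (rcons (hp p) y).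
  rewrite (eq_bigr (fun v => step R (last u p) v * phi (f v))); last first.
    by move=> v _; rewrite /hp hproj_rcons /phi; case: ifP.
  rewrite (fq (last u p) phi) {1}/phi eqxx.
  (* [phi] can differ from the continuation of [W] only at the current vertex of H, where [step] is
     0. *)
  have -> : \sum_y step R (f (last u p)) y * phi y = W (hp p) - 1.
    rewrite (W_step nA) [1 + _]addrC addrK /mean /hp last_hproj.
    apply: eq_bigr => y _; rewrite /phi; case: eqP => // ->.
    by rewrite /step adj_irr !mul0r.
  have -> : c * ((1 - q (last u p)) * W (hp p) + q (last u p) * (W (hp p) - 1)) =
      c * W (hp p) - c * q (last u p) by ring.
  by have := cq (last u p); lra.
have tk0 k : P k -> 0 <= kappa / t k.
  by move=> /t_gt0 ?; rewrite divr_ge0// ltW.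
apply: le_trans (_ : G [::] <= _).
  rewrite -subr_ge0.
  have := @min_principle R F Fdeg _ (last u) (@rcons F) (fun=> True) (fun p => A (hp p))
    (fun p => G p - eF (last u p) (vis p)) (fun p => c * W (hp p)) CF.
  have -> : [set u] = vis [::] by apply/setP => x; rewrite !inE.
  apply => //.
  - by move=> p _; rewrite mulr_ge0.
  - by move=> p _; exact: WS.
  - move=> p _; have /andP[_ FC] := bF (last u p) (vis p).
    rewrite -[leLHS]add0r lerD ?lerN2// addr_ge0 ?mulr_ge0 ?addr_ge0//.
    by apply: sumr_ge0 => k Pk; rewrite mulr_ge0 ?tk0 ?Q0.
  - move=> p _ Ap; rewrite subr_ge0.
    have := cover_le_blocks Fconn Fgt1 fq c0 cq eFP eHP rho1 osc block_le (last_vis p).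
    move=> /le_trans; apply; rewrite /G W_stop// add0r; apply: lerD.
      by rewrite ler_wpM2l.
    rewrite mulr_sumr (bigID P) /= [X in _ + X]big1 ?addr0; last first.
      by move=> k; rewrite negbK => /eqP ->; rewrite finset.sub0set mulr0.
    apply: ler_sum => k Pk; have [_|kV] := boolP (block k \subset vis p).
      by rewrite mulr0 mulr_ge0 ?tk0 ?Q0.
    (* A block not yet covered at the blanket time has been visited at least [t k] times, so its
       accumulated charge pays for a whole detour. *)
    rewrite mulr1 mulrAC ler_pdivlMr ?t_gt0// ler_wpM2l//.
    have /(thr_t k) /le_trans : forall x, thr x (count_mem x (f u :: hp p)).
      exact/forallP.
    apply; apply: le_trans (_ : (count (mem (block k)) (u :: p))%:R <= _).
      rewrite ler_nat (leq_trans (count_hproj f _ u p))//.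
      by apply: sub_count => x /=; rewrite inE.
    rewrite lastI -cats1 count_cat natrD /Q (negbTE kV) lerD2l /=.
    (* [Phi] is at least [2 * B k], hence at least 1, which makes up for the current vertex missing
       from [N]. *)
    have := cover_potential_lb (B0 k Pk) (h0 k) (last u p) kV.
    rewrite -/(Phi _ _ _); apply: le_trans; apply: le_trans (B1 k Pk).
    by rewrite addn0 lern1 leq_b1.
  - move=> p _ nA; rewrite meanB.
    have -> : mean (last u) (@rcons F) G p =
        mean (last u) (@rcons F) (fun p => c * W (hp p)) p + c * covH +
        \sum_(k | P k) kappa / t k * mean (last u) (@rcons F) (Q k) p.
      rewrite /G meanD mean_sum; congr (_ + _).
        rewrite -[c * covH](mean_cst Fdeg (last u) (@rcons F) _ p) -meanD.
        by apply: eq_mean => v _; rewrite mulrDr.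
      by apply: eq_bigr => k _; rewrite meanZ.
    have : \sum_(k | P k) kappa / t k * mean (last u) (@rcons F) (Q k) p <=
        \sum_(k | P k) kappa / t k * Q k p.
      by apply: ler_sum => k Pk; rewrite ler_wpM2l ?tk0 ?QS.
    have := WS p nA; have := cover_value_step eFP (last u p) (vis p).
    have -> : mean (last u) (@rcons F) (fun p => eF (last u p) (vis p)) p =
        \sum_v step R (last u p) v * eF v (v |: vis p).
      by apply: eq_bigr => v _; rewrite last_rcons visS.
    rewrite /G mulrDr.
    by move: (mean _ _ _ _) (\sum_v _) (\sum_(k | P k) _) (\sum_(k | P k) _) => *; lra.
rewrite /G lerD2l; apply: ler_sum => k Pk; rewrite ler_wpM2l ?tk0//.
have -> : Q k [::] = Phi k u (vis [::]) by rewrite /Q /N /=; case: ifP => _; rewrite add0r.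
have -> : 4 * rho * vol R (block k) = 2 * B k by rewrite /B; ring.
apply: cover_potential_ub => //; first exact: B0.
- by move=> z v; exact: hB.
- by apply: leq_trans (block_le k); rewrite card_gt0.
Qed.

End BlanketPhase.

(** * Resistance in Cartesian products *)

Section RealSums.
Variable R : realType.

Lemma sqrD_le (a b : R) : (a + b) ^+ 2 <= 2 * a ^+ 2 + 2 * b ^+ 2.
Proof.
rewrite -subr_ge0 (_ : _ - _ = (a - b) ^+ 2) ?sqr_ge0//; ring.
Qed.

Lemma weighted_cauchy_schwarz (I : finType) (w d : I -> R) : (forall i, 0 < w i) ->
  (\sum_i d i) ^+ 2 <= (\sum_i w i) * \sum_i (w i)^-1 * d i ^+ 2.
Proof.
move=> w0; set S := \sum_i d i; set W := \sum_i w i; set T := \sum_i _.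
have W0 : 0 <= W by apply: sumr_ge0 => i _; exact: ltW.
have T0 : 0 <= T by apply: sumr_ge0 => i _; rewrite mulr_ge0 ?sqr_ge0// invr_ge0 ltW.
have [WE|WN] := eqVneq W 0.
  have e (i : I) : False.
    suff : 0 < W by rewrite WE ltxx.
    rewrite /W (bigD1 i)//= ltr_wpDr ?w0//; apply: sumr_ge0 => j _; exact: ltW.
  by rewrite /S big1 ?expr0n ?mulr_ge0// => i; case: (e i).
have : 0 <= \sum_i w i * (d i / w i - S / W) ^+ 2.
  by apply: sumr_ge0 => i _; rewrite mulr_ge0 ?sqr_ge0// ltW.
have -> : \sum_i w i * (d i / w i - S / W) ^+ 2 = T - S ^+ 2 / W.
  transitivity (T - 2 * (S / W) * S + (S / W) ^+ 2 * W); last by field.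
  rewrite /T /W {3}/S !mulr_sumr -sumrB -big_split /=; apply: eq_bigr => i _.
  by have := w0 i => wi; field; rewrite WN gt_eqF.
by rewrite subr_ge0 ler_pdivrMr ?lt_neqAle 1?eq_sym ?WN// mulrC.
Qed.

Lemma cauchy_schwarz_nat (m : nat) (d : nat -> R) :
  (\sum_(i < m) d i) ^+ 2 <= m%:R * \sum_(i < m) d i ^+ 2.
Proof.
have := @weighted_cauchy_schwarz 'I_m (fun=> 1) (fun i => d i) (fun=> ltr01).
rewrite sumr_const card_ord => /le_trans; apply; rewrite ler_wpM2l//.
by under eq_bigr do rewrite invr1 mul1r.
Qed.

Lemma ln_inv_le (m : nat) : (0 < m)%N -> m.+1%:R^-1 <= ln m.+1%:R - ln m%:R :> R.
Proof.
move=> m0; have m0' : (0 : R) < m%:R by rewrite ltr0n.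
have mS : (0 : R) < m.+1%:R by rewrite ltr0n.
have := @le_ln1Dx R (m%:R / m.+1%:R - 1); rewrite subrKC ln_div ?posrE// => H.
have /H : -1 < m%:R / m.+1%:R - 1 :> R by rewrite ltrBrDl subrr divr_gt0.
have -> : m%:R / m.+1%:R = 1 - m.+1%:R^-1 :> R.
  by rewrite -natr1; field; rewrite natr1 gt_eqF.
by move: (ln _) (ln _) (_^-1) => *; lra.
Qed.

Lemma harmonic_le (m : nat) : \sum_(i < m) i.+1%:R^-1 <= 1 + ln m%:R :> R.
Proof.
(* For m = 0 the convention ln 0 = 0 makes the bound true. *)
case: m => [|m]; first by rewrite big_ord0 ln0// addr0.
elim: m => [|m IH]; first by rewrite big_ord1 invr1 ln1 addr0.
rewrite big_ord_recr /=; have := @ln_inv_le m.+1 isT; move: IH.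
set a := \sum_(i < m.+1) _; set b := ln _; set d := ln _; set k := _^-1.
by move: a b d k => a b d k *; lra.
Qed.

End RealSums.

Section Exhaustion.
Variable G : sgraph.
Hypothesis Gconn : connected_graph G.

(* As long as the list does not exhaust G, an edge leaves it. *)
Lemma enum_by_distance (x : G) : exists s : seq G,
  [/\ uniq s, size s = nvert G, nth x s 0 = x &
    forall i, (i < size s)%N -> (dist x (nth x s i) <= i)%N].
Proof.
suff [s [us sz s0 sd]] : exists s : seq G, [/\ uniq s, size s = (nvert G).-1.+1, nth x s 0 = x &
    forall i, (i < size s)%N -> (dist x (nth x s i) <= i)%N].
  exists s; split=> //; rewrite sz prednK//; apply/card_gt0P; by exists x.
have : ((nvert G).-1 < nvert G)%N by rewrite prednK//; apply/card_gt0P; exists x.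
elim: (nvert G).-1 => [_|m IH mG].
  by exists [:: x]; split=> // -[|]//= _; rewrite dist_eq0.
have [s [us sz s0 sd]] := IH (ltnW mG).
have [v vs [w ws vw]] : exists2 v, v \in s & exists2 w, w \notin s & adj v w.
  have [y ys] : exists y, y \notin s.
    apply/existsP; rewrite -negb_forall; apply: contraL mG => /forallP h.
    rewrite -leqNgt -sz -(card_uniqP us); apply/subset_leq_card/fintype.subsetP => y _; exact: h.
  have xs : x \in s by rewrite -s0 mem_nth// sz.
  have [p [pp lp _ _]] := dist_path Gconn x y.
  move: (x) xs pp lp; elim: p => /= [|z p IHp] v vs; first by move=> _ E; rewrite -E vs in ys.
  case/andP=> vz pz lz; have [zs|zs] := boolP (z \in s); first exact: IHp zs pz lz.
  by exists v => //; exists z.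
exists (rcons s w); split.
- by rewrite rcons_uniq ws.
- by rewrite size_rcons sz.
- by rewrite nth_rcons sz.
- move=> i; rewrite size_rcons nth_rcons ltnS leq_eqVlt => /predU1P[->|iS]; last first.
    by rewrite iS sd.
  rewrite ltnn eqxx (leq_trans (dist_triangle Gconn x v w))//.
  have vi : (index v s < size s)%N by rewrite index_mem.
  have dvw : (dist v w <= 1)%N by apply: (@dist_le _ v w [:: w]) => //=; rewrite vw.
  have := sd _ vi; rewrite nth_index// => dxv.
  by apply: leq_trans (leq_add dxv dvw) _; rewrite addn1.
Qed.

End Exhaustion.

Section PathEnergy.
Variables (R : realType) (G : sgraph).

Lemma sum_inj_le (I J : finType) (g : I -> J) (f : J -> R) :
  injective g -> (forall v, 0 <= f v) -> \sum_i f (g i) <= \sum_v f v.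
Proof.
move=> gi f0; rewrite -(big_imset f (A := predT)) /=; last by move=> a b _ _; exact: gi.
by rewrite big_mkcond; apply: ler_sum => v _; case: ifP.
Qed.

Lemma sum_uniq_nth_le (f : G -> R) (x0 : G) (s : seq G) (k j : nat) :
  (forall v, 0 <= f v) -> uniq s -> (j + k <= size s)%N ->
  \sum_(i < k) f (nth x0 s (j + i)) <= \sum_v f v.
Proof.
move=> f0 us ks; apply: (@sum_inj_le _ _ (fun i : 'I_k => nth x0 s (j + i)) f) => //.
have lt (i : 'I_k) : (j + i < size s)%N by rewrite (leq_trans _ ks)// ltn_add2l.
by move=> a b /eqP; rewrite nth_uniq// eqn_add2l => /eqP/val_inj.
Qed.

Hypothesis Gconn : connected_graph G.

(** Effective resistance is at most distance: Cauchy-Schwarz along a geodesic, whose vertices are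
    distinct. *)
Lemma dist_energy (phi : G -> R) (u v : G) :
  (phi u - phi v) ^+ 2 <= (dist u v)%:R * energy phi.
Proof.
have [p [pp lp up <-]] := dist_path Gconn u v.
pose a i := nth u (u :: p) i.
have pE : path adj u p -> forall i, (i < size p)%N -> adj (a i) (a i.+1).
  by move=> /(pathP u) h i ip; exact: h.
have -> : phi u - phi v = \sum_(i < size p) (phi (a i) - phi (a i.+1)).
  rewrite -[LHS]opprB -lp (last_nth u) -/(a _) -[phi u]/(phi (a 0%N)).
  rewrite -(telescope_sumr (fun i => phi (a i)) (leq0n _)) big_mkord -sumrN.
  by apply: eq_bigr => i _; rewrite opprB.
apply: le_trans (cauchy_schwarz_nat _ (fun i => phi (a i) - phi (a i.+1))) _.
rewrite ler_wpM2l//.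
apply: le_trans (_ : \sum_(i < size p) \sum_(w | adj (a (0 + i)%N) w)
  (phi (a (0 + i)%N) - phi w) ^+ 2 <= _).
  apply: ler_sum => i _; rewrite add0n (bigD1 (a i.+1)) ?pE//= lerDl.
  by apply: sumr_ge0 => w _; rewrite sqr_ge0.
apply: (sum_uniq_nth_le (f := fun v => \sum_(w | adj v w) (phi v - phi w) ^+ 2)) => //.
by move=> w; apply: sumr_ge0 => x _; rewrite sqr_ge0.
Qed.

End PathEnergy.

(** * Averages over growing sets along a geodesic of G *)

Section ProductEnergy.
Variables (R : realType) (G H : sgraph).

Lemma sum_box_adj (u : box G H) (psi : G * H -> R) :
  \sum_(v : box G H | adj u v) psi v =
  \sum_(y | adj u.2 y) psi (u.1, y) + \sum_(a | adj u.1 a) psi (a, u.2).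
Proof.
case: u => g x /=; rewrite (bigID (fun v : G * H => v.1 == g)) /=; congr (_ + _).
  rewrite (reindex_onto (pair g) snd) /=; last first.
    by move=> [a y] /= /andP[_ /eqP ->].
  apply: eq_big => y; last by [].
  by rewrite /box_adj /= eqxx adj_irr andbT eqxx andbT.
rewrite (reindex_onto (fun a => (a, x)) fst) /=; last first.
  by move=> [a y] /=; rewrite /box_adj /= => /andP[/orP[/andP[_ /eqP->]//|/andP[/eqP->]]]; rewrite eqxx.
apply: eq_big => a; last by [].
rewrite /box_adj /= adj_irr andbF orbF eqxx andbT eqxx andbT.
by case: eqP => [->|_]; rewrite ?adj_irr ?andbF ?andbT.
Qed.

Definition penergy (phi : G -> H -> R) : R :=
  \sum_g energy (phi g) + \sum_x energy (phi^~ x).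

Lemma energy_box (phi : G * H -> R) :
  @energy R (box G H) phi = penergy (fun g x => phi (g, x)).
Proof.
transitivity (\sum_g \sum_x
    \sum_(v : box G H | adj ((g, x) : box G H) v) (phi (g, x) - phi v) ^+ 2).
  by rewrite pair_bigA; apply: eq_bigr => -[g x] _.
rewrite /penergy [X in _ = _ + X]exchange_big /= -big_split /=.
apply: eq_bigr => g _; rewrite -big_split /=; apply: eq_bigr => x _.
exact: (sum_box_adj ((g, x) : box G H) (fun v => (phi (g, x) - phi v) ^+ 2)).
Qed.

Hypothesis Gconn : connected_graph G.
Hypothesis Hconn : connected_graph H.
Variable phi : G -> H -> R.

(** Energy localised at c: [e1] collects the G-edges leaving the fibre over c, [e2] the H-edges
    inside it. *)
Let e1 (c : G) : R := \sum_y \sum_(w | adj c w) (phi c y - phi w y) ^+ 2.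
Let e2 (c : G) : R := energy (phi c).

Let e1_ge0 c : 0 <= e1 c.
Proof. by apply: sumr_ge0 => y _; apply: sumr_ge0 => w _; rewrite sqr_ge0. Qed.

Let e2_ge0 c : 0 <= e2 c.
Proof. exact: energy_ge0. Qed.

Let e12 : \sum_c e2 c + \sum_c e1 c = penergy phi.
Proof. by rewrite /penergy; congr (_ + _); rewrite exchange_big. Qed.

Variables (x : H) (s : seq H).
Hypotheses (us : uniq s) (s0 : nth x s 0 = x).
Hypothesis sd : forall i, (i < size s)%N -> (dist x (nth x s i) <= i)%N.

Let avg (m : nat) (c : G) : R := (\sum_(j < m) phi c (nth x s j)) / m%:R.

(** Changing the fibre costs [e1 c / m] by Cauchy-Schwarz ([D1]). Adding the m-th vertex moves the
    average by the sum of its m differences from the earlier values divided by m (m + 1), and each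
    difference squared is at most [2 * m * e2 c'] because distances are below 2 m ([D2]). *)
Let avg_step (m : nat) (c c' : G) : (0 < m)%N -> (m < size s)%N -> adj c c' ->
  (avg m c - avg m.+1 c') ^+ 2 <= 4 / m%:R * (e1 c + e2 c').
Proof.
move=> m0 ms cc'.
have m0' : (0 : R) < m%:R by rewrite ltr0n.
have mS : (0 : R) < m.+1%:R by rewrite ltr0n.
have D1 : (avg m c - avg m c') ^+ 2 <= e1 c / m%:R.
  rewrite /avg -mulrBl -sumrB expr_div_n ler_pdivrMr ?exprn_gt0//.
  have -> : e1 c / m%:R * m%:R ^+ 2 = m%:R * e1 c by field; rewrite gt_eqF.
  apply: le_trans (cauchy_schwarz_nat _ (fun j => phi c (nth x s j) - phi c' (nth x s j))) _.
  rewrite ler_wpM2l//.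
  apply: le_trans (_ : \sum_y (phi c y - phi c' y) ^+ 2 <= _).
    have := @sum_uniq_nth_le R H (fun y => (phi c y - phi c' y) ^+ 2) x s m 0.
    by rewrite add0n; apply=> // [y|]; rewrite ?sqr_ge0// ltnW.
  apply: ler_sum => y _; rewrite (bigD1 c')//= lerDl.
  by apply: sumr_ge0 => w _; rewrite sqr_ge0.
have D2 : (avg m c' - avg m.+1 c') ^+ 2 <= 2 * e2 c' / m%:R.
  have -> : avg m c' - avg m.+1 c' =
      (\sum_(j < m) (phi c' (nth x s j) - phi c' (nth x s m))) / (m%:R * m.+1%:R).
    rewrite /avg big_ord_recr /= sumrB sumr_const card_ord -[phi c' _ *+ m]mulr_natl.
    rewrite -natr1; field; rewrite natr1 !gt_eqF//.
  rewrite expr_div_n ler_pdivrMr ?exprn_gt0 ?mulr_gt0//.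
  apply: le_trans (cauchy_schwarz_nat _ (fun j => phi c' (nth x s j) - phi c' (nth x s m))) _.
  apply: le_trans (_ : m%:R * \sum_(j < m) ((2 * m%:R) * e2 c') <= _).
    rewrite ler_wpM2l//; apply: ler_sum => j _.
    apply: le_trans (dist_energy Hconn _ _ _) _; rewrite ler_wpM2r ?energy_ge0//.
    rewrite -natrM ler_nat (leq_trans (dist_triangle Hconn _ x _))//.
    have jm := ltn_ord j; have js := ltn_trans jm ms.
    rewrite mul2n -addnn leq_add ?sd// dist_sym// (leq_trans (sd js))// ltnW//.
  rewrite sumr_const card_ord -[(_ * e2 c') *+ m]mulr_natl.
  have -> : 2 * e2 c' / m%:R * (m%:R * m.+1%:R) ^+ 2 = m.+1%:R ^+ 2 * (2 * e2 c' * m%:R).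
    by field; rewrite gt_eqF.
  have -> : m%:R * (m%:R * (2 * m%:R * e2 c')) = m%:R ^+ 2 * (2 * e2 c' * m%:R) :> R by ring.
  by rewrite ler_wpM2r ?mulr_ge0// lerXn2r ?nnegrE// ler_nat.
have -> : avg m c - avg m.+1 c' = (avg m c - avg m c') + (avg m c' - avg m.+1 c').
  by rewrite addrA subrK.
move: D1 D2; set a := avg m c - _; set b := avg m c' - _ => D1 D2.
have := sqrD_le a b.
have e1m : 0 <= e1 c / m%:R by rewrite divr_ge0.
have -> : 4 / m%:R * (e1 c + e2 c') = 4 * (e1 c / m%:R) + 2 * (2 * e2 c' / m%:R).
  by field; rewrite gt_eqF.
by lra.
Qed.

(** The weights 1 / (i + 1) in Cauchy-Schwarz cancel the factor 1 / m of [avg_step]. Their sum is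
    the logarithm, and the local energies at distinct vertices add up to at most [penergy phi]. *)
Lemma avg_dist (g w : G) : (dist g w < size s)%N ->
  (phi g x - avg (dist g w).+1 w) ^+ 2 <=
  4 * (1 + ln (dist g w)%:R) * penergy phi.
Proof.
have [p [pp lp up <-]] := dist_path Gconn g w; set k := size p => ks.
pose a i := nth g (g :: p) i.
have pE i : (i < k)%N -> adj (a i) (a i.+1).
  by move: pp => /(pathP g) h ip; exact: h.
pose F i := avg i.+1 (a i).
have -> : phi g x - avg k.+1 w = \sum_(i < k) (F i - F i.+1).
  have -> : phi g x = F 0%N by rewrite /F /avg big_ord1 s0 divr1.
  have -> : avg k.+1 w = F k by rewrite /F /a -last_nth lp.
  rewrite -[LHS]opprB -(telescope_sumr F (leq0n _)) big_mkord -sumrN.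
  by apply: eq_bigr => i _; rewrite opprB.
have w0 (i : 'I_k) : (0 : R) < i.+1%:R^-1 by rewrite invr_gt0 ltr0n.
apply: le_trans (weighted_cauchy_schwarz (fun i : 'I_k => F i - F i.+1) w0) _.
have h0 : (0 : R) <= \sum_(i < k) i.+1%:R^-1 by apply: sumr_ge0 => i _; rewrite ltW.
have E0 : 0 <= 4 * penergy phi by rewrite -e12 mulr_ge0// addr_ge0// sumr_ge0.
apply: le_trans (_ : (\sum_(i < k) i.+1%:R^-1) * (4 * penergy phi) <= _); last first.
  rewrite mulrAC [4 * _ * _]mulrC; exact: ler_wpM2r (harmonic_le R k).
rewrite ler_wpM2l//.
apply: le_trans (_ : \sum_(i < k) 4 * (e1 (a (0 + i)%N) + e2 (a (1 + i)%N)) <= _).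
  apply: ler_sum => i _; rewrite invrK add0n add1n.
  have i0 : (0 : R) < i.+1%:R by rewrite ltr0n.
  have ik : (i.+1 < size s)%N by apply: leq_ltn_trans ks; exact: ltn_ord.
  have := avg_step (isT : (0 < i.+1)%N) ik (pE i (ltn_ord i)).
  move=> /(ler_wpM2l (ltW i0)) /le_trans; apply.
  by rewrite mulrA [_ * (4 / _)]mulrC divfK// gt_eqF.
rewrite -mulr_sumr ler_wpM2l// big_split /= -e12 addrC.
by apply: lerD; apply: sum_uniq_nth_le => //=; rewrite ?add1n.
Qed.

End ProductEnergy.

Section Oscillation.
Variable R : realType.

Lemma dist_split (G : sgraph) (g g' : G) (m k : nat) : connected_graph G ->
  dist g g' = (m + k)%N -> exists w, dist g w = m /\ dist w g' = k.
Proof.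
move=> Gc; elim: m g => [|m IH] g E; first by exists g; rewrite dist_eq0.
have gg' : g != g' by apply: contra_eq_neq E => ->; rewrite dist_eq0.
have [v gv dv] := dist_closer Gc gg'.
have d1 : (dist g v <= 1)%N by apply: (@dist_le _ g v [:: v]) => //=; rewrite gv.
have t := dist_triangle Gc g v g'.
have [w [vw wg]] : exists w, dist v w = m /\ dist w g' = k by apply: IH; lia.
exists w; split=> //.
have := dist_triangle Gc g v w; have := dist_triangle Gc g w g'; lia.
Qed.

Lemma penergy_sym (G H : sgraph) (phi : G -> H -> R) :
  penergy (fun x g => phi g x) = penergy phi.
Proof. by rewrite /penergy addrC. Qed.

Lemma penergy_ge0 (G H : sgraph) (phi : G -> H -> R) : 0 <= penergy phi.
Proof. by rewrite addr_ge0// sumr_ge0// => ? _; exact: energy_ge0. Qed.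

(* From both ends of a geodesic of the form {g .. g'} * {x}, average over larger
   and larger sets of vertices of H; both averages agree at the midpoint. *)
Lemma oscillation_fst (G H : sgraph) (phi : G -> H -> R) (g g' : G) (x : H) (N : nat) :
  connected_graph G -> connected_graph H ->
  ((dist g g')./2 < nvert H)%N -> (0 < N)%N -> ((dist g g')./2 <= N)%N ->
  (phi g x - phi g' x) ^+ 2 <= (34 + 32 * ln N%:R) * penergy phi.
Proof.
move=> Gc Hc kH N0 kN; set k := (dist g g')./2 in kH kN.
have [s [us sz s0 sd]] := enum_by_distance Hc x.
(* If the distance is odd, one initial step makes it even, so that a midpoint exists. *)
have [v [gv vg']] : exists v, (dist g v <= 1)%N /\ dist v g' = (k + k)%N.
  have := odd_double_half (dist g g'); rewrite -/k -addnn.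
  case: (odd _) => /= E; last by exists g; rewrite dist_eq0.
  by have [v [gv vg]] := dist_split Gc (esym E); exists v; rewrite gv.
have [w [vw wg']] := dist_split Gc vg'.
have E0 := penergy_ge0 phi.
have ln_le : ln k%:R <= ln N%:R :> R.
  case: (posnP k) => [->|k0]; first by rewrite ln0// ln_ge0// ler1n.
  by rewrite ler_ln ?posrE ?ltr0n// ler_nat.
have A1 : (phi g x - phi v x) ^+ 2 <= penergy phi.
  apply: le_trans (dist_energy Gc (phi^~ x) g v) _.
  apply: le_trans (_ : energy (phi^~ x) <= _).
    by rewrite ler_piMl ?energy_ge0// lern1.
  rewrite /penergy (bigD1 x)//= addrCA lerDl addr_ge0 ?sumr_ge0// => ? _;
  exact: energy_ge0.
have := avg_dist Gc Hc phi us s0 sd (g := v) (w := w).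
rewrite sz vw => /(_ kH); set a := _ / _ => A2.
have := avg_dist Gc Hc phi us s0 sd (g := g') (w := w).
rewrite sz dist_sym// wg' => /(_ kH); rewrite -/a => A3.
have -> : phi g x - phi g' x = (phi g x - phi v x) + ((phi v x - a) + (a - phi g' x)).
  by ring.
apply: le_trans (sqrD_le _ _) _; have := sqrD_le (phi v x - a) (a - phi g' x).
have -> : (a - phi g' x) ^+ 2 = (phi g' x - a) ^+ 2 by ring.
have : 4 * (1 + ln k%:R) * penergy phi <= 4 * (1 + ln N%:R) * penergy phi.
  by rewrite ler_wpM2r// ler_wpM2l// lerD2l.
(* [sqrD_le] applied twice gives weight 2 to the initial step and 4 to each half. *)
have -> : (34 + 32 * ln N%:R) * penergy phi =
    2 * penergy phi + 8 * (4 * (1 + ln N%:R) * penergy phi) by ring.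
by move: A1 A2 A3; move: (_ * penergy phi) (_ * penergy phi) => *; lra.
Qed.

Lemma ln2_ge : 2^-1 <= ln 2 :> R.
Proof.
have := @ln_inv_le R 1 isT; rewrite ln1 subr0; exact: le_trans.
Qed.

(** Move first in G, then in H with the factors exchanged; the bound [2 * diam G] lets the half
    distance in H fit into G. As ln (D + 1) is at least 1/2, each leg costs at most 100 ln (D + 1),
    and [sqrD_le] doubles their sum. *)
Lemma oscillation_box (G H : sgraph) (phi : box G H -> R) (a b : box G H) :
  connected_graph G -> connected_graph H -> (1 < nvert G)%N ->
  (diam G < nvert H)%N -> (dist a.2 b.2 <= 2 * diam G)%N ->
  (phi a - phi b) ^+ 2 <= 400 * ln (diam G).+1%:R * energy phi.
Proof.
move=> Gc Hc G1 GH dH; rewrite energy_box; set p := fun g x => _.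
have DG := diam_lt_nvert Gc (ltnW G1).
have dG := dist_diam a.1 b.1.
have D0 := diam_gt0 Gc G1.
have E0 := penergy_ge0 p.
have A1 : (p a.1 a.2 - p b.1 a.2) ^+ 2 <= (34 + 32 * ln (diam G).+1%:R) * penergy p.
  by apply: oscillation_fst => //; lia.
have A2 : (p b.1 a.2 - p b.1 b.2) ^+ 2 <= (34 + 32 * ln (diam G).+1%:R) * penergy p.
  rewrite -penergy_sym; apply: (@oscillation_fst H G (fun x g => p g x)) => //; lia.
have ab (c : box G H) : phi c = p c.1 c.2 by case: c.
rewrite !ab -(subrKA (p b.1 a.2)).
apply: le_trans (sqrD_le _ _) _.
have lnD : 2^-1 <= ln (diam G).+1%:R :> R.
  by apply: le_trans ln2_ge _; rewrite ler_ln ?posrE ?ltr0n// ler_nat.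
have : (34 + 32 * ln (diam G).+1%:R) * penergy p <= 100 * ln (diam G).+1%:R * penergy p.
  rewrite ler_wpM2r//; move: (ln _) lnD => l; lra.
have -> : 400 * ln (diam G).+1%:R * penergy p = 4 * (100 * ln (diam G).+1%:R * penergy p) by ring.
by move: A1 A2; move: (_ * penergy p) (_ * penergy p) => *; lra.
Qed.

End Oscillation.

(** * Partition of H and the box graph *)

Section Centers.
Variable H : sgraph.
Hypothesis Hconn : connected_graph H.

Let separated (D : nat) (Z : {set H}) :=
  [forall z in Z, forall w in Z, (z != w) ==> (D < dist z w)%N].

Lemma ball_card (x : H) (r : nat) : (r < nvert H)%N ->
  (r.+1 <= #|[set y | (dist x y <= r)%N]|)%N.
Proof.
move=> rn; have [s [us sz _ sd]] := enum_by_distance Hconn x.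
have ut : uniq (take r.+1 s) by exact: take_uniq.
have st : size (take r.+1 s) = r.+1 by rewrite size_takel// sz.
rewrite -{1}st -(card_uniqP ut); apply/subset_leq_card/fintype.subsetP => y.
move=> /(nthP x)[i]; rewrite st => ir <-; rewrite inE nth_take//.
by rewrite (leq_trans (sd i _))// sz (leq_ltn_trans _ rn).
Qed.

(* Balls of radius D / 2 around the points of a maximal D-separated set are
   disjoint, balls of radius D cover. *)
Lemma center_exists (D : nat) : (D < nvert H)%N -> exists bl : H -> H,
  (forall x y, bl x = bl y -> (dist x y <= 2 * D)%N) /\
  (#|[set bl x | x in H]| * D.+1 <= 2 * nvert H)%N.
Proof.
move=> DH.
have [Z /maxsetP[Zsep Zmax]] : {Z | maxset (separated D) Z}.
  apply: ex_maxset; exists finset.set0; apply/forall_inP => z; by rewrite inE.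
have near x : exists z, (z \in Z) && (dist z x <= D)%N.
  apply: contrapT => /forallNP far'; have far z := introN idP (far' z).
  have xZ : x \notin Z by apply/negP => xZ; have := far x; rewrite xZ dist_eq0.
  have : (x |: Z) = Z.
    apply: Zmax; last exact: finset.subsetUr.
    apply/forall_inP => z zZ; apply/forall_inP => w wZ; apply/implyP => zw.
    move: zZ wZ zw; rewrite !inE => /predU1P[->|zZ] /predU1P[->|wZ] zw.
    - by rewrite eqxx in zw.
    - by have := far w; rewrite wZ -ltnNge dist_sym.
    - by have := far z; rewrite zZ -ltnNge.
    - exact: (implyP (forall_inP (forall_inP Zsep z zZ) w wZ)).
  by move/setP/(_ x); rewrite !inE eqxx (negbTE xZ).
have /choice[bl blP] := near.
exists bl; split=> [x y E|].
  have /andP[_ dx] := blP x; have /andP[_ dy] := blP y.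
  rewrite mul2n -addnn (leq_trans (dist_triangle Hconn x (bl x) y))// leq_add//.
    by rewrite dist_sym.
  by rewrite E.
have sub : [set bl x | x in H] \subset Z.
  by apply/fintype.subsetP => _ /imsetP[x _ ->]; have /andP[] := blP x.
apply: leq_trans (leq_mul (subset_leq_card sub) (leqnn _)) _.
(* The half-radius balls are disjoint, and each has more than D / 2 vertices. *)
have : (#|Z| * (D./2).+1 <= nvert H)%N.
  rewrite -sum_nat_const.
  have D2 : (D./2 < nvert H)%N by rewrite (leq_ltn_trans _ DH)//; lia.
  apply: (@leq_trans (\sum_(z in Z) #|[set y | (dist z y <= D./2)%N]|)).
    by apply: leq_sum => z _; exact: ball_card.
  apply: leq_trans (_ : \sum_(y : H) 1 <= _)%N; last by rewrite sum1_card.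
  under eq_bigr => z _ do rewrite -sum1_card big_mkcond.
  rewrite exchange_big /=; apply: leq_sum => y _.
  rewrite -big_mkcondr sum1_card; apply/card_le1_eqP => z w.
  move=> /andP[zZ +] /andP[wZ +]; rewrite !inE => dz dw; apply/eqP/negPn/negP => zw.
  have := implyP (forall_inP (forall_inP Zsep w wZ) z zZ) zw.
  apply/negP; rewrite -leqNgt.
  by apply: leq_trans (dist_triangle Hconn w y z) _; rewrite [dist y z]dist_sym//; lia.
nia.
Qed.

(* Cells around the centers, cut into pieces of at most D + 1 vertices. *)
Lemma block_map_exists (D : nat) : (D < nvert H)%N ->
  exists bl : H -> H * 'I_(nvert H).+1,
  [/\ forall x y, bl x = bl y -> (dist x y <= 2 * D)%N,
      forall k, (#|[set x | bl x == k]| <= D.+1)%N &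
      (#|[set bl x | x in H]| * D.+1 <= 3 * nvert H)%N].
Proof.
move=> DH; have [c [cdist ccard]] := center_exists DH.
pose cell z := enum [set y | c y == z].
have cellP x : x \in cell (c x) by rewrite mem_enum inE.
pose idx x := index x (cell (c x)).
have idx_lt x : (idx x < size (cell (c x)))%N by rewrite index_mem.
have size_cell z : (size (cell z) <= nvert H)%N by rewrite -cardE max_card.
(* Pieces consist of D + 1 consecutive indices of a cell: the quotient names the piece, and the
   remainder is injective on it. *)
pose bl x : H * 'I_(nvert H).+1 := (c x, inord (idx x %/ D.+1)).
have blE x : ((bl x).2 : nat) = (idx x %/ D.+1)%N.
  rewrite /= inordK// ltnS (leq_trans (leq_div _ _))// ltnW//.
  exact: leq_trans (idx_lt x) (size_cell _).
exists bl; split.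
- by move=> x y [/cdist].
- move=> [z j].
  pose g (x : H) : 'I_D.+1 := inord (idx x %% D.+1).
  have gi : {in [set x | bl x == (z, j)] &, injective g}.
    move=> x y; rewrite !inE => /eqP xk /eqP yk gxy.
    have cE : c x = c y by have := congr1 fst xk; have := congr1 fst yk => /= -> ->.
    have dE : (idx x %/ D.+1 = idx y %/ D.+1)%N by rewrite -!blE xk yk.
    have mE : (idx x %% D.+1 = idx y %% D.+1)%N.
      by have := congr1 (@nat_of_ord _) gxy; rewrite !inordK// ltn_mod.
    have iE : idx x = idx y by rewrite (divn_eq (idx x) D.+1) dE mE -divn_eq.
    rewrite -(nth_index x (cellP x)) -/(idx x) iE cE.
    by rewrite nth_index.
  by rewrite -(card_in_imset gi) -[leqRHS]card_ord max_card.
(* A cell yields at most one incomplete piece: the full ones account for [nvert H], the extra ones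
   for [2 * nvert H] by the bound on the number of centers. *)
- apply: (@leq_trans (\sum_(z in [set c x | x in H]) (size (cell z) %/ D.+1).+1 * D.+1)).
    rewrite -big_distrl leq_mul2r /= -sum1_card.
    rewrite (partition_big fst (mem [set c x | x in H])) /=; last first.
      by move=> p /imsetP[x _ ->]; apply: imset_f.
    apply: leq_sum => z _; rewrite sum1dep_card.
    apply: (@leq_trans #|[set (z, inord (val j)) | j in 'I_(size (cell z) %/ D.+1).+1]|).
      apply/subset_leq_card/fintype.subsetP => p.
      rewrite inE => /andP[/imsetP[x _ ->] /eqP /= cz].
      have lt : (idx x %/ D.+1 < (size (cell z) %/ D.+1).+1)%N.
        by rewrite ltnS leq_div2r// ltnW// -cz.
      by apply/imsetP; exists (Ordinal lt); rewrite // /bl cz.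
    by rewrite (leq_trans (leq_imset_card _ _))// card_ord.
  apply: (@leq_trans (\sum_(z in [set c x | x in H]) (size (cell z) + D.+1))).
    by apply: leq_sum => z _; rewrite mulSn addnC leq_add2r leq_divM.
  rewrite big_split /= sum_nat_const.
  have -> : (3 * nvert H = nvert H + 2 * nvert H)%N by lia.
  apply: leq_add => //.
  rewrite /nvert -[leqRHS]sum1_card [leqRHS](partition_big c (mem [set c x | x in H])) /=.
    apply: leq_sum => z _; rewrite sum1dep_card -cardE; apply: subset_leq_card.
    by apply/fintype.subsetP => y; rewrite !inE.
  by move=> x _; apply: imset_f.
Qed.

End Centers.

Section BoxFacts.
Variables (R : realType) (G H : sgraph).

Lemma box_connected : connected_graph G -> connected_graph H -> connected_graph (box G H).
Proof.
move=> Gc Hc [a x] [b y].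
apply: (@connect_trans _ _ ((b, x) : box G H)).
  have [p pp ->] := connectP (Gc a b).
  elim: p a pp => [|c p IH] a /=; first by rewrite connect0.
  case/andP=> ac pp; apply: connect_trans (IH c pp); apply: connect1.
  by rewrite /= /box_adj /= ac eqxx.
have [p pp ->] := connectP (Hc x y).
elim: p x pp => [|c p IH] x /=; first by rewrite connect0.
case/andP=> ac pp; apply: connect_trans (IH c pp); apply: connect1.
by rewrite /= /box_adj /= ac eqxx orbT.
Qed.

Lemma nvert_box : nvert (box G H) = (nvert G * nvert H)%N.
Proof. by rewrite /nvert card_prod. Qed.

Lemma mindeg_le (u : G) : (mindeg G <= deg u)%N.
Proof. by apply: (@bigminn_leq _ _ _ (@deg G)) => //; exact: mem_index_enum. Qed.

Lemma maxdeg_ge (u : G) : (deg u <= maxdeg G)%N.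
Proof. exact: (leq_bigmax_cond (F := @deg G)). Qed.

Lemma nvert_le_nedge : (forall u : G, (0 < deg u)%N) -> (nvert G <= 2 * nedge G)%N.
Proof.
move=> dg; rewrite -handshake /nvert -sum1_card.
by apply: leq_sum => u _; exact: dg.
Qed.

Lemma mindeg_gt0 : (0 < nvert G)%N -> (forall u : G, (0 < deg u)%N) -> (0 < mindeg G)%N.
Proof.
by move=> n0 dg; rewrite /mindeg; elim/big_rec: _ => // u m _ m0; rewrite leq_min dg.
Qed.

Hypothesis Gdeg : forall u : G, (0 < deg u)%N.
Hypothesis Hdeg : forall u : H, (0 < deg u)%N.

Let degB (u : box G H) : (deg u)%:R = (deg u.1)%:R + (deg u.2)%:R :> R.
Proof. by rewrite deg_box natrD. Qed.

Let degB0 (u : box G H) : (deg u.1)%:R + (deg u.2)%:R != 0 :> R.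
Proof. by rewrite -natrD pnatr_eq0 -lt0n addn_gt0 Gdeg. Qed.

Lemma lazy_snd : lazy_proj (F := box G H) snd
  (fun u => (deg u.2)%:R / ((deg u.1)%:R + (deg u.2)%:R) : R).
Proof.
move=> u phi; rewrite !sum_step sum_box_adj /= sumr_const degB.
rewrite -[phi u.2 *+ _]mulr_natl.
have -> : (#|(fun a => adj u.1 a)| = deg u.1)%N by rewrite /deg cardsE.
by field; rewrite degB0 pnatr_eq0 -lt0n Hdeg.
Qed.

Lemma lazy_fst : lazy_proj (F := box G H) fst
  (fun u => (deg u.1)%:R / ((deg u.1)%:R + (deg u.2)%:R) : R).
Proof.
move=> u phi; rewrite !sum_step sum_box_adj /= sumr_const degB.
rewrite -[phi u.1 *+ _]mulr_natl.
have -> : (#|(fun a => adj u.2 a)| = deg u.2)%N by rewrite /deg cardsE.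
by field; rewrite degB0 pnatr_eq0 -lt0n Gdeg.
Qed.

End BoxFacts.

(** * Bounds for the box graph *)

Section CoverTimeValues.
Variables (R : realType) (G : sgraph).
Hypothesis Gconn : connected_graph G.
Hypothesis nvert_gt1 : (1 < nvert G)%N.
Let deg_gt0 := conn_deg_gt0 Gconn nvert_gt1.
Variables (e : G -> {set G} -> R) (C : R).
Hypothesis eP : cover_value e C.

Definition cov_val : R := \big[Order.max/0]_(u : G) e u [set u].

Lemma cov_valE : COV R G = cov_val%:E.
Proof.
have [_ _ _ cov] := eP.
by rewrite /COV (eq_bigr _ (fun u _ => cov u)) (big_morph EFin (@EFin_max R) erefl).
Qed.

Lemma cov_val_ge u : e u [set u] <= cov_val.
Proof. exact: le_bigmax. Qed.

Lemma cov_val_gt0 : 0 < cov_val.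
Proof.
have /card_gt0P[u _] : (0 < #|{: G}|)%N by apply: ltn_trans nvert_gt1.
apply: lt_le_trans (cov_val_ge u); have [e0 _ eS _] := eP.
rewrite eS; last first.
  apply: contraTneq nvert_gt1 => E; rewrite -leqNgt /nvert -cardsT -E.
  by rewrite cards1.
rewrite ltr_wpDr//; apply: sumr_ge0 => v _; rewrite mulr_ge0 ?step_ge0//.
by case/andP: (e0 v (v |: [set u])).
Qed.

Let thr (v : G) (k : nat) := stationary R v * cov_val <= k%:R.

Let blankets_thr s : blankets R s = [forall v, thr v (count_mem v s)].
Proof. by apply: eq_forallb => v; rewrite cov_valE -EFinM lee_fin. Qed.

Let stationary_gt0 (v : G) : 0 < stationary R v.
Proof.
rewrite /stationary divr_gt0 ?ltr0n ?deg_gt0//.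
exact: leq_trans (ltnW nvert_gt1) (nvert_le_nedge deg_gt0).
Qed.

(* The cover time of the walk is at most its blanket time as every blanket
   threshold is positive. *)
Lemma blanket_value_exists (u : G) : exists W : seq G -> R, exists CW : R,
  [/\ forall s, 0 <= W s <= CW,
      forall s, [forall v, thr v (count_mem v (u :: s))] -> W s = 0,
      forall s, ~~ [forall v, thr v (count_mem v (u :: s))] ->
        W s = 1 + mean (last u) (@rcons G) W s,
      expected_stop R (@blankets R G) u = (W [::])%:E &
      e u [set u] <= W [::]].
Proof.
have thr_mono v m n : (m <= n)%N -> thr v m -> thr v n.
  by move=> mn /le_trans; apply; rewrite ler_nat.
have [K thrK] : exists K, forall v, thr v K.
  exists (Num.bound (\sum_(v : G) stationary R v * cov_val)) => v; rewrite /thr.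
  have P0 (w : G) : 0 <= stationary R w * cov_val.
    by apply: mulr_ge0; apply: ltW; [exact: stationary_gt0 | exact: cov_val_gt0].
  apply: le_trans (ltW (archi_boundP _)); last exact: sumr_ge0.
  by rewrite (bigD1 v)//= lerDl sumr_ge0.
have [W [CW [Wb W0 WS]]] := count_value_exists R Gconn nvert_gt1 u thr_mono thrK.
exists W, CW; split=> //.
  apply: (expected_stopE deg_gt0 Wb) => p; rewrite blankets_thr; [exact: W0|exact: WS].
have [eb eT eS _] := eP.
pose A s := [forall v, thr v (count_mem v (u :: s))].
pose vis p := [set x in u :: p].
rewrite -subr_ge0.
have -> : [set u] = vis [::] by apply/setP => x; rewrite !inE.
apply: (@min_principle R G deg_gt0 _ (last u) (@rcons G) (fun=> True) A
  (fun p => W p - e (last u p) (vis p)) W C _ _ _ _ _ _ [::]) => //.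
- by move=> p _; case/andP: (Wb p).
- by move=> p _ /WS ->.
- move=> p _; have /andP[W0' _] := Wb p; have /andP[_ e1] := eb (last u p) (vis p); lra.
- move=> p _ Ap; rewrite W0// (_ : vis p = [set: G]) ?eT ?subrr//.
  apply/setP => v; rewrite !inE; have := forallP Ap v; rewrite /thr.
  apply: contraTT => vp; rewrite (count_memPn _) ?inE//.
  by rewrite -ltNge mulr_gt0 ?stationary_gt0 ?cov_val_gt0.
- move=> p _ nA; rewrite meanB (WS p nA); have := cover_value_step eP (last u p) (vis p).
  have -> : mean (last u) (@rcons G) (fun p => e (last u p) (vis p)) p =
      \sum_v step R (last u p) v * e v (v |: vis p).
    apply: eq_bigr => v _; rewrite last_rcons; congr (_ * e _ _).
    by apply/setP => x; rewrite !inE mem_rcons !inE orbCA.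
  by move: (mean _ _ _ _) (\sum_v _) => *; lra.
Qed.

End CoverTimeValues.

(** * Constants and the two bounds in real numbers *)

Section CoverTimeBounds.
Variable R : realType.

(** The factor 3 comes from the number of blocks, 48 from the detour cost, 160 = 2 * 4 * 4 * 5 from
    [block_term_le], and 400 from the resistance bound, used twice. *)
Definition upper_const : R := 3 * (48 * 160) * 400 ^+ 2.

Lemma upper_const_gt0 : 0 < upper_const.
Proof.
apply: mulr_gt0; first by lra.
by apply: exprn_gt0; rewrite ltr0n.
Qed.

Lemma count_sum_mem (T : finType) (a : pred T) (s : seq T) :
  count a s = (\sum_(x | a x) count_mem x s)%N.
Proof.
elim: s => [|y s IH] /=; first by rewrite big1.
rewrite IH big_split /=; congr addn; have [ay|ay] := boolP (a y).
  rewrite (bigD1 y)//= eqxx big1 ?addn0// => x /andP[_ /negbTE].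
  by rewrite eq_sym => ->.
by rewrite big1// => x ax; case: eqP => // E; rewrite E ax in ay.
Qed.

Let detour_cost_le (M rho lam l : R) : 0 <= M -> 0 <= rho -> 2^-1 <= lam -> l <= 3 * lam ->
  4 * M * rho * (3 + 2 * l) <= 48 * M * rho * lam.
Proof.
move=> M0 rho0 lam_ge l3; have -> : 48 * M * rho * lam = 4 * M * rho * (12 * lam) by ring.
by apply: ler_wpM2l; [rewrite mulr_ge0 ?mulr_ge0|lra].
Qed.

Let block_term_le (M rho lam l mG mH cH d kap vol : R) :
  0 <= M -> 0 <= rho -> 2^-1 <= lam -> 0 <= l -> l <= 3 * lam -> 0 <= mG ->
  0 < mH -> 0 < cH -> 0 < d -> 0 <= kap -> kap <= 48 * M * rho * lam ->
  0 <= vol -> vol <= 4 * mG * d ->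
  kap / (d / (2 * mH) * cH) * (4 * rho * vol * (1 + l)) <=
  48 * 160 * rho ^+ 2 * lam ^+ 2 * M * mG * mH / cH.
Proof.
move=> M0 rho0 lam_ge l0 l3 mG0 mH0 cH0 d0 kap0 kap_le vol0 vol_le.
have t0 : 0 < d / (2 * mH) * cH by rewrite mulr_gt0// divr_gt0// mulr_gt0.
have -> : 48 * 160 * rho ^+ 2 * lam ^+ 2 * M * mG * mH / cH =
    48 * M * rho * lam / (d / (2 * mH) * cH) * (4 * rho * (4 * mG * d) * (5 * lam)).
  by field; rewrite !gt_eqF.
have r4 : 0 <= 4 * rho by rewrite mulr_ge0.
apply: ler_pM.
- by rewrite divr_ge0// ltW.
- by rewrite mulr_ge0 ?addr_ge0// mulr_ge0.
- by rewrite ler_wpM2r// invr_ge0 ltW.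
apply: ler_pM; [by rewrite mulr_ge0 | by rewrite addr_ge0 | by rewrite ler_wpM2l | lra].
Qed.

Lemma cov_val_lower (F H : sgraph) (f : F -> H) (q : F -> R) (c : R)
  (eF : F -> {set F} -> R) (CF : R) (eH : H -> {set H} -> R) (CH : R) :
  connected_graph F -> (1 < nvert F)%N -> connected_graph H -> (1 < nvert H)%N ->
  lazy_proj f q -> (forall x, exists u, f u = x) -> 0 < c -> (forall u, c * q u <= 1) ->
  cover_value eF CF -> cover_value eH CH -> c * cov_val eH <= cov_val eF.
Proof.
move=> Fc F1 Hc H1 fq fs c0 cq eFP eHP.
rewrite mulrC -ler_pdivlMr//; apply: bigmax_le => [|x _].
  by rewrite divr_ge0 ?ltW// (cov_val_gt0 F1 eFP).
have [u <-] := fs x; rewrite ler_pdivlMr// mulrC.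
apply: le_trans (cov_val_ge eF u).
have := cover_lower Fc F1 fq fs eFP eHP (ltW c0) cq (finset.set11 u).
by rewrite imset_set1.
Qed.

Variables G H : sgraph.
Hypotheses (Gc : connected_graph G) (Hc : connected_graph H).
Hypotheses (G1 : (1 < nvert G)%N) (H1 : (1 < nvert H)%N).
Local Notation F := (box G H).
Let Fc : connected_graph F := box_connected Gc Hc.
Let F1 : (1 < nvert F)%N.
Proof. by rewrite nvert_box (leq_trans H1)// leq_pmull// ltnW. Qed.
Let Gdeg := conn_deg_gt0 Gc G1.
Let Hdeg := conn_deg_gt0 Hc H1.

Let degR_gt0 (K : sgraph) (u : K) : (0 < deg u)%N -> (0 : R) < (deg u)%:R.
Proof. by rewrite ltr0n. Qed.

Let ratio_lower (dG dH : nat) (a b : R) : (0 < dH)%N -> dG%:R <= a -> 0 < b -> b <= dH%:R ->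
  (1 + dG%:R / dH%:R) * (b / (a + b)) <= 1.
Proof.
move=> dH0 ga b0 bH; have dH0' : (0 : R) < dH%:R by rewrite ltr0n.
have a0 : 0 <= a by apply: le_trans ga.
rewrite mulrA ler_pdivrMr ?ltr_wpDl// mul1r mulrDl mul1r addrC lerD2r.
by rewrite mulrAC ler_pdivrMr// ler_pM// ltW.
Qed.

Let ratio_upper (dG dH : nat) (a b : R) :
  (0 < dH)%N -> 0 <= a -> a <= dG%:R -> 0 < b -> dH%:R <= b ->
  1 <= (1 + dG%:R / dH%:R) * (b / (a + b)).
Proof.
move=> dH0 a0 ga b0 bH; have dH0' : (0 : R) < dH%:R by rewrite ltr0n.
rewrite mulrA ler_pdivlMr ?ltr_wpDl// mul1r mulrDl mul1r addrC lerD2l.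
by rewrite mulrAC ler_pdivlMr// ler_pM// ltW.
Qed.

Let maxdeg_gt0 (K : sgraph) : (1 < nvert K)%N -> (forall u : K, (0 < deg u)%N) -> (0 < maxdeg K)%N.
Proof.
move=> K1 dg; have /card_gt0P[u _] : (0 < #|{: K}|)%N by apply: ltn_trans K1.
exact: leq_trans (dg u) (maxdeg_ge u).
Qed.

Variables (eF : F -> {set F} -> R) (CF : R).
Hypothesis eFP : cover_value eF CF.

Lemma box_lower_snd (eH : H -> {set H} -> R) (CH : R) : cover_value eH CH ->
  (1 + (mindeg G)%:R / (maxdeg H)%:R) * cov_val eH <= cov_val eF.
Proof.
move=> eHP; have /card_gt0P[a _] : (0 < #|{: G}|)%N by apply: ltn_trans G1.
apply: (cov_val_lower Fc F1 Hc H1 (lazy_snd Gdeg Hdeg) _ _ _ eFP eHP).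
- by move=> x; exists (a, x).
- by rewrite ltr_pwDl// divr_ge0.
- move=> u; apply: ratio_lower; rewrite ?ler_nat ?mindeg_le ?maxdeg_ge ?degR_gt0 ?maxdeg_gt0//.
Qed.

Lemma box_lower_fst (eG : G -> {set G} -> R) (CG : R) : cover_value eG CG ->
  (1 + (mindeg H)%:R / (maxdeg G)%:R) * cov_val eG <= cov_val eF.
Proof.
move=> eGP; have /card_gt0P[x _] : (0 < #|{: H}|)%N by apply: ltn_trans H1.
apply: (cov_val_lower Fc F1 Gc G1 (lazy_fst Gdeg) _ _ _ eFP eGP).
- by move=> a; exists (a, x).
- by rewrite ltr_pwDl// divr_ge0.
- move=> u; rewrite [(deg u.1)%:R + _]addrC.
  by apply: ratio_lower; rewrite ?ler_nat ?mindeg_le ?maxdeg_ge ?degR_gt0 ?maxdeg_gt0.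
Qed.

Variables (eH : H -> {set H} -> R) (CH : R).
Hypothesis eHP : cover_value eH CH.
Hypothesis GH : (diam G < nvert H)%N.
Let D := diam G.
Let L : R := ln D.+1%:R.
Let lam : R := ln (nvert G * D)%:R.
Let n := (nvert G * D.+1)%N.
Let D0 : (0 < D)%N := diam_gt0 Gc G1.

Let nGD : (2 <= nvert G * D)%N.
Proof. by rewrite (leq_trans G1)// leq_pmulr. Qed.

Let ln2_le_lam : ln 2 <= lam.
Proof. by rewrite ler_ln ?posrE ?ltr0n ?ler_nat// (leq_trans _ nGD). Qed.

Let lam_ge : 2^-1 <= lam.
Proof. exact: le_trans (ln2_ge R) ln2_le_lam. Qed.

Let L_ge : 2^-1 <= L.
Proof. by apply: le_trans (ln2_ge R) _; rewrite ler_ln ?posrE ?ltr0n// ler_nat. Qed.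

(** Since D + 1 <= 2 D, the argument is at most [4 * nvert G * D], and ln 2 is at most [lam]. *)
Let ln_2n : ln (2 * n%:R) <= 3 * lam.
Proof.
have nGD0 : (0 : R) < (nvert G * D)%:R by rewrite ltr0n (leq_trans _ nGD).
apply: (@le_trans _ _ (ln (2 * (2 * (nvert G * D)%:R)))).
  rewrite ler_ln ?posrE ?mulr_gt0// ?ltr0n ?muln_gt0 ?(ltnW G1)//.
  rewrite ler_pM2l// -natrM ler_nat /n mulnCA leq_mul2l; apply/orP; right.
  by rewrite mul2n -addnn -addn1 leq_add2l.
rewrite !lnM ?posrE ?mulr_gt0//; have := ln2_le_lam; rewrite -/lam; lra.
Qed.

Lemma box_upper (bcov : R) (u : F) :
  (forall x W, expected_stop R (@blankets R H) x = W%:E -> W <= bcov) ->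
  eF u [set u] <= upper_const *
    ((1 + (maxdeg G)%:R / (mindeg H)%:R) * bcov +
     (nedge F)%:R * (nedge G)%:R * (nedge H)%:R * (nvert H)%:R * (L * lam) ^+ 2 /
       (cov_val eH * D%:R)).
Proof.
move=> bcovP.
set c := 1 + _; set cH := cov_val eH.
have cH0 : 0 < cH := cov_val_gt0 H1 eHP.
have mH0 : (0 : R) < (2 * nedge H)%:R.
  by rewrite ltr0n (leq_trans _ (nvert_le_nedge Hdeg))// ltnW.
have c0 : 0 <= c by rewrite addr_ge0// divr_ge0.
have mindegH : (0 < mindeg H)%N by apply: mindeg_gt0 => //; exact: ltnW.
have cq (v : F) : 1 <= c * ((deg v.2)%:R / ((deg v.1)%:R + (deg v.2)%:R)).
  by apply: ratio_upper; rewrite ?ler_nat ?mindeg_le ?maxdeg_ge ?degR_gt0.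
have [bl [bl_dist bl_size bl_num]] := block_map_exists Hc GH.
have [rho rhoE] : exists rho : R, rho = 400 * L by exists (400 * L).
have rho1 : 1 <= rho by have := L_ge; rewrite rhoE; lra.
have osc k (a b : F) (phi : F -> R) : a \in @block F H snd _ bl k -> b \in @block F H snd _ bl k ->
    (phi a - phi b) ^+ 2 <= rho * energy phi.
  rewrite !inE => /eqP ak /eqP bk; rewrite rhoE; apply: oscillation_box => //.
  by apply: bl_dist; rewrite ak bk.
have block_le k : (#|@block F H snd _ bl k| <= n)%N.
  have -> : @block F H snd _ bl k = finset.setX [set: G] [set x | bl x == k].
    by apply/setP => -[a x]; rewrite !inE.
  by rewrite cardsX cardsT leq_mul.
pose d k : R := \sum_(x | bl x == k) (deg x)%:R.
(* Sum of the blanket thresholds over the vertices of block k. *)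
pose t k : R := d k / (2 * nedge H)%:R * cH.
pose P k := @block F H snd _ bl k != finset.set0.
have d0 k : P k -> 0 < d k.
  move=> /set0Pn[[a x]]; rewrite inE /= => xk; rewrite /d (bigD1 x)//=.
  by rewrite ltr_pwDl ?sumr_ge0// ltr0n.
have t0 k : P k -> 0 < t k by move=> /d0 ?; rewrite /t mulr_gt0// divr_gt0.
pose thr (x : H) (m : nat) := stationary R x * cH <= m%:R.
have thr_t s k : (forall x, thr x (count_mem x s)) ->
    t k <= (count (fun x => bl x == k) s)%:R.
  move=> h; rewrite count_sum_mem natr_sum /t /d !mulr_suml; apply: ler_sum => x _.
  exact: h.
have [W [CW [Wb W0 WS WE We]]] := blanket_value_exists Hc H1 eHP u.2.
have := cover_le_blanket Fc F1 (lazy_snd Gdeg Hdeg) c0 cq eFP eHP rho1 osc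
  block_le t0 thr_t (cov_val_ge eH) Wb W0 WS.
move=> /le_trans; apply.
have W_le : W [::] <= bcov by apply: bcovP WE.
have cH_le : cH <= bcov.
  apply: bigmax_le => [|x _]; first by apply: le_trans W_le; case/andP: (Wb [::]).
  have [W' [_ [_ _ _ WE' We']]] := blanket_value_exists Hc H1 eHP x.
  exact: le_trans We' (bcovP _ _ WE').
set M : R := (nedge F)%:R; set mG : R := (nedge G)%:R; set mH : R := (nedge H)%:R.
have mH0' : 0 < mH by move: mH0; rewrite natrM pmulr_rgt0.
have M0 : 0 <= M by rewrite ler0n.
have mG0 : 0 <= mG by rewrite ler0n.
(* Each x contributes 2 [mG] plus [nvert G] times its degree; the degree is at least 1 and [nvert G]
   at most 2 [mG]. *)
have vol_le k : vol R (@block F H snd _ bl k) <= 4 * mG * d k.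
  have -> : vol R (@block F H snd _ bl k) =
      \sum_(x | bl x == k) \sum_(a : G) ((deg a)%:R + (deg x)%:R).
    rewrite exchange_big pair_big_dep /vol /=.
    by apply: eq_big => [[a x]|[a x] _]; rewrite ?inE// deg_box natrD.
  rewrite /d mulr_sumr; apply: ler_sum => x _.
  have x1 : (1 : R) <= (deg x)%:R by rewrite ler1n.
  have nG : (nvert G)%:R <= 2 * mG by rewrite -natrM ler_nat nvert_le_nedge.
  rewrite big_split /= -natr_sum handshake sumr_const -[X in _ + X]mulr_natl natrM.
  have := ler_wpM2r (ler0n R (deg x)) nG.
  have := ler_wpM2l (mulr_ge0 (ler0n R 2) mG0) x1.
  by rewrite mulr1 -/mG -[#|xpredT|]/(nvert G); lra.
have L0 : 0 <= L by apply: le_trans L_ge; rewrite invr_ge0.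
have rho0 : 0 <= rho by apply: le_trans rho1.
have kap_le : detour_cost F rho n <= 48 * M * rho * lam by exact: detour_cost_le.
have ln0 : 0 <= ln (2 * n%:R) :> R.
  by rewrite ln_ge0// -natrM ler1n !muln_gt0 (ltnW G1).
have kap0 : 0 <= detour_cost F rho n := detour_cost_ge0 rho1 block_le u.
have [T TE] : exists T : R, T = 48 * 160 * rho ^+ 2 * lam ^+ 2 * M * mG * mH / cH.
  by eexists.
have term_le k : P k -> detour_cost F rho n / t k *
    (4 * rho * vol R (@block F H snd _ bl k) * (1 + ln (2 * n%:R))) <= T.
  move=> Pk; rewrite TE /t natrM; apply: block_term_le => //; first exact: d0.
  exact: vol_ge0.
have T0 : 0 <= T.
  have k0 : (0 : R) <= 48 * 160 by lra.
  rewrite TE; exact: divr_ge0 (mulr_ge0 (mulr_ge0 (mulr_ge0 (mulr_ge0 (mulr_ge0 k0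
    (sqr_ge0 _)) (sqr_ge0 _)) M0) mG0) (ltW mH0')) (ltW cH0).
have D0' : (0 : R) < D%:R by rewrite ltr0n.
have num_le : (#|P|%:R : R) <= 3 * (nvert H)%:R / D%:R.
  rewrite ler_pdivlMr// -!natrM ler_nat (leq_trans _ bl_num)// leq_mul//.
  apply/subset_leq_card/fintype.subsetP => k /set0Pn[[a x]]; rewrite inE => /eqP <-.
  by apply: imset_f.
have sum_le : \sum_(k | P k) detour_cost F rho n / t k *
    (4 * rho * vol R (@block F H snd _ bl k) * (1 + ln (2 * n%:R))) <=
    3 * (nvert H)%:R / D%:R * T.
  apply: (@le_trans _ _ (\sum_(k | P k) T)); first exact: ler_sum.
  by rewrite sumr_const -[T *+ _]mulr_natl ler_wpM2r.
rewrite /upper_const [leRHS]mulrDr.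
have -> : 3 * (48 * 160) * 400 ^+ 2 * (M * mG * mH * (nvert H)%:R * (L * lam) ^+ 2 / (cH * D%:R)) =
    3 * (nvert H)%:R / D%:R * T.
  by rewrite TE rhoE; field; rewrite !gt_eqF.
apply: lerD => //.
have cb0 : 0 <= c * bcov by rewrite mulr_ge0// (le_trans _ cH_le)// ltW.
apply: (@le_trans _ _ (c * (bcov + bcov))); first by rewrite ler_wpM2l// lerD.
rewrite mulrDr -mulr2n -[leLHS]mulr_natl ler_wpM2r//.
have h4 : (1 : R) <= 400 ^+ 2 by rewrite exprn_ege1// ler1n.
have h3 : (1 : R) <= 48 * 160 by lra.
have h34 : (1 : R) <= 48 * 160 * 400 ^+ 2 by rewrite mulr_ege1.
by rewrite -[leRHS]mulrA; lra.
Qed.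

End CoverTimeBounds.

Unset Implicit Arguments.

Theorem theorem39 (R : realType) :
  exists K : R, 0 < K /\
  forall G H : sgraph,
    connected_graph G -> connected_graph H ->
    (2 <= nvert G)%N -> (2 <= nvert H)%N ->
    let F := box G H in
    (maxe ((1 + (mindeg G)%:R / (maxdeg H)%:R)%:E * COV R H)
          ((1 + (mindeg H)%:R / (maxdeg G)%:R)%:E * COV R G)
       <= COV R F)%E /\
    ((diam G + 1 <= nvert H)%N ->
     let M : R := (nedge F)%:R in
     let l : R := ln (diam G + 1)%:R * ln (nvert G * diam G)%:R in
     (COV R F <=
        K%:E *
        ((1 + (maxdeg G)%:R / (mindeg H)%:R)%:E * BCOV R H
         + (M * (nedge G)%:R * (nedge H)%:R * (nvert H)%:R * l ^+ 2)%:E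
           / (COV R H * (diam G)%:R%:E)))%E).
Proof.
exists (upper_const R); split; first exact: upper_const_gt0.
move=> G H Gc Hc G1 H1 F.
have Fc : connected_graph F by exact: box_connected.
have F1 : (1 < nvert F)%N by rewrite nvert_box (leq_trans H1)// leq_pmull// ltnW.
have [eF [CF eFP]] := cover_value_exists R Fc F1.
have [eG [CG eGP]] := cover_value_exists R Gc G1.
have [eH [CH eHP]] := cover_value_exists R Hc H1.
rewrite (cov_valE eFP) (cov_valE eGP) (cov_valE eHP); split.
  rewrite -!EFinM -EFin_max lee_fin ge_max.
  by rewrite (box_lower_snd Gc Hc G1 H1 eFP eHP) (box_lower_fst Gc Hc G1 H1 eFP eGP).
rewrite addn1 => GH; cbv zeta.
have /choice[w wE] x : exists r : R, expected_stop R (@blankets R H) x = r%:E.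
  by have [W [_ [_ _ _ WE _]]] := blanket_value_exists Hc H1 eHP x; exists (W [::]).
have -> : BCOV R H = (\big[Order.max/0]_(x : H) w x)%:E.
  rewrite /BCOV (eq_bigr _ (fun x _ => wE x)).
  by rewrite (big_morph EFin (@EFin_max R) erefl).
(* A positive denominator turns the division of extended reals into one of reals. *)
have den_gt0 : 0 < cov_val eH * (diam G)%:R.
  by rewrite mulr_gt0 ?(cov_val_gt0 H1 eHP)// ltr0n diam_gt0.
rewrite -[X in (_ / X)%E]EFinM inver gt_eqF// -!EFinM lee_fin.
have bcovP x W : expected_stop R (@blankets R H) x = W%:E ->
    W <= \big[Order.max/0]_(x : H) w x.
  by rewrite wE => -[<-]; exact: le_bigmax.
(* The maximum defining [cov_val] starts from 0, so the right-hand side must also be shown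
   nonnegative. *)
apply: bigmax_le => [|u _]; last exact: (box_upper Gc Hc G1 H1 eFP eHP GH u bcovP).
apply: mulr_ge0; first exact: ltW (upper_const_gt0 R).
apply: addr_ge0.
  by apply: mulr_ge0; [rewrite addr_ge0// divr_ge0 | exact: bigmax_ge_id].
apply: divr_ge0; last exact: ltW.
by apply: mulr_ge0; [rewrite !mulr_ge0 ?ler0n | exact: sqr_ge0].
Qed.
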